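(* Let $A_1,\dots,A_p\in\mathbb{C}^{m\times n}$ have Gaussian integer entries of absolute value at most $M$, and let $R^*$ be the right subspace of the dominant independent set of $\operatorname{span}\{A_1,\dots,A_p\}$. Then the entries of the orthogonal projection $\pi_{R^*}$ are (Gaussian) rational numbers with a common denominator at most $M_1 = e^{O(n^5\log(Mn))}$.
   Context: Subspaces $L\subseteq\mathbb{C}^m$, $R\subseteq\mathbb{C}^n$ form an independent set if $x^\dagger A_iy=0$ for all $x\in L,y\in R,i$. Among independent sets maximizing $\dim L+\dim R$, there is a unique one $(L^*,R^* )$ with $L^*$ maximal and $R^*$ minimal (the dominant independent set); $R^*$ is the smallest maximally shrunk subspace. *)

(* Defs.v *)
From mathcomp Require Import all_boot all_order all_algebra.
From mathcomp Require Import sesquilinear spectral.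
From mathcomp.real_closed Require Import complex.
From mathcomp Require Import boolp reals.

Set Implicit Arguments.
Unset Strict Implicit.
Unset Printing Implicit Defensive.

Import Order.TTheory GRing.Theory Num.Theory.
Local Open Scope ring_scope.
Local Open Scope sesquilinear_scope.

Section Independent.
Variables (C : numClosedFieldType) (m n p : nat) (A : 'I_p -> 'M[C]_(m, n)).

Implicit Types (L : {vspace 'cV[C]_m}) (R : {vspace 'cV[C]_n}).

Definition independent L R : Prop :=
  forall x y (i : 'I_p), x \in L -> y \in R -> x ^t* *m A i *m y = 0.

Definition max_independent L R : Prop :=
  independent L R /\
  forall L' R', independent L' R' -> (\dim L' + \dim R' <= \dim L + \dim R)%N.

Definition dominant_independent L R : Prop :=
  max_independent L R /\
  forall L' R', max_independent L' R' -> (L' <= L)%VS /\ (R <= R')%VS.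

Lemma max_independent_exists : exists L R, max_independent L R.
Proof.
suff H k L R : independent L R -> (m + n - (\dim L + \dim R) <= k)%N ->
    exists L' R', max_independent L' R'.
  have i0 : independent 0 0.
    by move=> x y i; rewrite memv0 => /eqP-> _; rewrite trmx0 map_mx0 !mul0mx.
  exact: H i0 (leqnn _).
elim: k L R => [|k IH] L R iLR hk.
  exists L, R; split=> // L' R' _.
  move: hk; rewrite leqn0 subn_eq0 => /(leq_trans _); apply.
  have := dimvS (subvf L'); have := dimvS (subvf R').
  by rewrite !dimvf /dim /= !muln1 => h1 h2; exact: leq_add.
have [[L' [R' [iL' lt]]]|nex] := EM (exists L' R',
    independent L' R' /\ (\dim L + \dim R < \dim L' + \dim R')%N).
  apply: IH iL' _; rewrite -ltnS; apply: leq_trans hk.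
  have le : (\dim L' + \dim R' <= m + n)%N.
    have := dimvS (subvf L'); have := dimvS (subvf R').
    by rewrite !dimvf /dim /= !muln1 => h1 h2; exact: leq_add.
  by rewrite ltn_sub2l // (leq_trans lt).
exists L, R; split=> // L' R' iL'; rewrite leqNgt; apply/negP=> lt.
by apply: nex; exists L', R'.
Qed.

Lemma independent_addl L1 R1 L2 R2 : independent L1 R1 -> independent L2 R2 ->
  independent (L1 + L2) (R1 :&: R2).
Proof.
move=> i1 i2 x y i /memv_addP[x1 h1 [x2 h2 ->]]; rewrite memv_cap => /andP[y1 y2].
by rewrite linearD /= map_mxD !mulmxDl i1 // i2 // addr0.
Qed.

Lemma independent_addr L1 R1 L2 R2 : independent L1 R1 -> independent L2 R2 ->
  independent (L1 :&: L2) (R1 + R2).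
Proof.
move=> i1 i2 x y i; rewrite memv_cap => /andP[x1 x2] /memv_addP[y1 h1 [y2 h2 ->]].
by rewrite mulmxDr i1 // i2 // addr0.
Qed.

Lemma max_independent_addl L1 R1 L2 R2 :
  max_independent L1 R1 -> max_independent L2 R2 ->
  max_independent (L1 + L2) (R1 :&: R2).
Proof.
move=> [i1 m1] [i2 m2]; split; first exact: independent_addl.
move=> L' R' /m1 /leq_trans; apply.
have := m2 _ _ (independent_addr i1 i2).
have := dimv_sum_cap L1 L2; have := dimv_sum_cap R1 R2.
set a := \dim (R1 + R2); set b := \dim (R1 :&: R2).
set c := \dim (L1 + L2); set d := \dim (L1 :&: L2) => eR eL le.
rewrite -(leq_add2r (\dim L2 + \dim R2)) addnACA -eL -eR.
by rewrite [(a + b)%N]addnC addnACA leq_add2l.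
Qed.

Lemma dominant_independent_exists : exists L R, dominant_independent L R.
Proof.
suff H k L R : max_independent L R -> (m - \dim L <= k)%N ->
    exists L' R', max_independent L' R' /\
      forall L2 R2, max_independent L2 R2 -> (\dim L2 <= \dim L')%N.
  have [L0 [R0 mx0]] := max_independent_exists.
  have [L [R [mx hL]]] := H _ _ _ mx0 (leqnn _).
  exists L, R; split=> // L' R' mx'.
  have mx2 := max_independent_addl mx mx'.
  have eL : (L == L + L')%VS by rewrite eqEdim addvSl (hL _ _ mx2).
  split; first by rewrite (eqP eL) addvSr.
  have /eqP <- : (R :&: R' == R)%VS.
    rewrite eqEdim capvSl /=.
    by have := mx2.2 _ _ mx.1; rewrite -(eqP eL) leq_add2l.
  exact: capvSr.
have bd L' : (\dim L' <= m)%N.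
  by have := dimvS (subvf L'); rewrite dimvf /dim /= muln1.
elim: k L R => [|k IH] L R mx hk.
  exists L, R; split=> // L' R' _.
  by move: hk; rewrite leqn0 subn_eq0 => /(leq_trans _); apply; exact: bd.
have [[L' [R' [mx' lt]]]|nex] := EM (exists L' R',
    max_independent L' R' /\ (\dim L < \dim L')%N).
  apply: IH mx' _; rewrite -ltnS; apply: leq_trans hk.
  by rewrite ltn_sub2l // (leq_trans lt) // bd.
exists L, R; split=> // L' R' mx'; rewrite leqNgt; apply/negP=> lt.
by apply: nex; exists L', R'.
Qed.

Lemma dominant_independent_unique L1 R1 L2 R2 :
  dominant_independent L1 R1 -> dominant_independent L2 R2 ->
  L1 = L2 /\ R1 = R2.
Proof.
move=> [m1 d1] [m2 d2].
have [a b] := d1 _ _ m2; have [c d] := d2 _ _ m1.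
by split; apply: subv_anti; rewrite ?a ?b ?c ?d.
Qed.

End Independent.

(* [proj_ortho] acts on row vectors on the right; transposing both the basis *)
(* and the result gives the projection acting on column vectors on the left.  *)
Definition orth_proj (C : numClosedFieldType) (n : nat)
    (U : {vspace 'cV[C]_n}) : 'M[C]_n :=
  (proj_ortho (\matrix_(i < \dim U) ((vbasis U)`_i)^T))^T.

Lemma orth_projP (C : numClosedFieldType) (n : nat) (U : {vspace 'cV[C]_n})
    (v : 'cV[C]_n) :
  orth_proj U *m v \in U /\
  forall u, u \in U -> u ^t* *m (v - orth_proj U *m v) = 0.
Proof.
rewrite /orth_proj; set B := \matrix_(i < _) _.
have memB (w : 'cV[C]_n) : (w^T <= B)%MS = (w \in U).
  apply/idP/idP => [/submxP[D eD]|wU].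
    have -> : w = \sum_(i < \dim U) D 0 i *: (vbasis U)`_i.
      apply: trmx_inj; rewrite eD mulmx_sum_row raddf_sum /=.
      by apply: eq_bigr => i _; rewrite rowK [RHS]linearZ.
    by apply: memv_suml => i _; apply/memvZ/vbasis_mem/mem_nth; rewrite size_tuple.
  rewrite (coord_vbasis wU) raddf_sum /=; apply: summx_sub => i _.
  by rewrite linearZ /= scalemx_sub // -(rowK (fun i => ((vbasis U)`_i)^T)) row_sub.
have e : ((proj_ortho B)^T *m v)^T = v^T *m proj_ortho B by rewrite trmx_mul trmxK.
split; first by rewrite -memB e proj_ortho_sub.
move=> u uU; have /submxP[D eD] : (u^T <= B)%MS by rewrite memB.
have := proj_ortho_compl_sub B v^T; rewrite -e -linearB /= => /orthomx1P h.
set w := v - _ in h *.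
apply: trmx_inj; rewrite trmx0 trmx_mul eD map_mxM trmx_mul.
by rewrite !map_trmx mulmxA h mul0mx.
Qed.

Definition gaussian_int (R : realType) (z : R[i]) : Prop :=
  complex.Re z \is a Num.int /\ complex.Im z \is a Num.int.

(* Main.v *)
(* Write f(U) = dim U - dim (sum_i A_i U), so that the right subspace V of the
   dominant independent set is the least maximizer of f; let c = f(V). Stretch
   C^n by a factor tau >= 1 orthogonally to V, and take a Korkin-Zolotarev
   reduced basis b_1, ..., b_n of Z[i]^n for the stretched norm. Let j be the
   first index such that V lies in the span of b_1, ..., b_j. Since f < c on the
   earlier spans, n - c independent images A_i b_l can be chosen so that, up to
   reducedness constants, their sources run over b_c, ..., b_n without b_j. They
   have a nonzero minor, which is a Gaussian integer. Stretching the target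
   orthogonally to sum_i A_i V as well, the Leibniz expansion bounds this minor
   from above by the product of the source lengths. The product of all basis
   lengths is comparable to the covolume tau^(n - dim V), the powers of tau
   cancel, and b_j, hence each of b_1, ..., b_j, is bounded by 2^(O(n^2))
   (nM)^(O(n)) independently of tau. As tau tends to infinity these vectors are
   forced into V: they form a Gaussian integer basis of V. The Gram determinant
   of that basis is a common denominator of the projection. *)

Require Import Defs.
From HB Require Import structures.
From mathcomp Require Import all_boot all_order all_algebra.
From mathcomp Require Import perm sesquilinear spectral.
From mathcomp.real_closed Require Import complex.
From mathcomp Require Import boolp reals sequences exp.
From mathcomp Require Import zify ring lra.

Set Implicit Arguments.
Unset Strict Implicit.
Unset Printing Implicit Defensive.

Import Order.TTheory GRing.Theory Num.Theory.
Local Open Scope ring_scope.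
Local Open Scope complex_scope.
Local Open Scope sesquilinear_scope.

(** * Gaussian integers *)

Section GaussianIntegers.
Variable R : realType.
Implicit Types z w : R[i].

Definition gaussInt : {pred R[i]} :=
  fun z => (complex.Re z \is a Num.int) && (complex.Im z \is a Num.int).

Lemma gaussIntP z : reflect (gaussian_int z) (z \in gaussInt).
Proof. exact: andP. Qed.

Lemma gaussIntE (a b : R) :
  (a +i* b \in gaussInt) = (a \is a Num.int) && (b \is a Num.int).
Proof. by []. Qed.

Fact gaussInt_subring : subring_closed gaussInt.
Proof.
split=> [|[a b] [c d]|[a b] [c d]]; rewrite ?gaussIntE.
- by rewrite rpred1 rpred0.
- by move=> /andP[? ?] /andP[? ?]; rewrite !rpredB.
- by move=> /andP[? ?] /andP[? ?]; rewrite rpredB ?rpredD ?rpredM.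
Qed.

HB.instance Definition _ := GRing.isSubringClosed.Build R[i] gaussInt
  gaussInt_subring.

Lemma gaussInt_conj z : z \in gaussInt -> z^* \in gaussInt.
Proof. by case: z => a b; rewrite /= !gaussIntE rpredN. Qed.

Lemma gaussInt_norm_ge1 z : z \in gaussInt -> z != 0 -> 1 <= `|z|.
Proof.
case: z => a b; rewrite gaussIntE => /andP[/intrP[x ->] /intrP[y ->]] nz.
suff : 1 <= `|x%:~R +i* y%:~R : R[i]| ^+ 2 by rewrite expr_ge1.
rewrite -add_Re2_Im2 /= -!rmorphXn /= -!rmorphD /= -[1]/(1%:C) lecR.
rewrite (ler_int _ 1).
move: nz; rewrite eq_complex /= !intr_eq0 negb_and; nia.
Qed.

(** Rounding each coordinate costs at most 1/4; the total 1/2 stays below the factor 3/4 of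
    [near_minimum], and lattice reduction lives on this gap. *)
Lemma gaussInt_approx z : exists2 w, w \in gaussInt & `|z - w| ^+ 2 <= 2^-1.
Proof.
case: z => a b.
have round (x : R) : exists k : int, (x - k%:~R) ^+ 2 <= 4^-1.
  exists (Num.floor (x + 2^-1)).
  have /andP[] := floor_itv (x + 2^-1); rewrite intrD; nra.
have [[k hk] [l hl]] := (round a, round b).
exists (k%:~R +i* l%:~R); first by rewrite gaussIntE !intr_int.
rewrite -add_Re2_Im2 /=.
have -> : (2^-1 : R[i]) = (2^-1)%:C by rewrite fmorphV /= rmorph_nat.
rewrite lecR; lra.
Qed.

Lemma det_gaussInt n (A : 'M[R[i]]_n) :
  A \is a mxOver gaussInt -> \det A \in gaussInt.
Proof.
move=> /mxOverP AG; apply: rpred_sum => s _.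
by rewrite rpredM ?rpredX ?rpredN ?rpred1 // rpred_prod.
Qed.

Lemma adj_gaussInt n (A : 'M[R[i]]_n) :
  A \is a mxOver gaussInt -> \adj A \is a mxOver gaussInt.
Proof.
move=> /mxOverP AG; apply/mxOverP => i j; rewrite !mxE.
rewrite rpredM ?rpredX ?rpredN ?rpred1 // det_gaussInt //.
by apply/mxOverP => k l; rewrite !mxE.
Qed.

End GaussianIntegers.

(** * Hermitian norm and unitary frames *)

Section HermitianNorm.
Variable C : numClosedFieldType.

Definition sqnorm n (v : 'rV[C]_n) : C := \sum_j `|v 0 j| ^+ 2.

Lemma sqnormE n (v : 'rV[C]_n) : sqnorm v = (v *m v ^t*) 0 0.
Proof. by rewrite mxE; apply: eq_bigr => j _; rewrite !mxE normCK. Qed.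

Lemma sqnorm_ge0 n (v : 'rV[C]_n) : 0 <= sqnorm v.
Proof. by apply: sumr_ge0 => j _; rewrite exprn_ge0. Qed.

Lemma sqnorm_ge n (v : 'rV[C]_n) j : `|v 0 j| ^+ 2 <= sqnorm v.
Proof.
by rewrite /sqnorm (bigD1 j) //= lerDl sumr_ge0 // => i _; rewrite exprn_ge0.
Qed.

Lemma sqnorm_eq0 n (v : 'rV[C]_n) : (sqnorm v == 0) = (v == 0).
Proof.
apply/eqP/eqP => [v0|->]; last first.
  by rewrite /sqnorm big1 // => j _; rewrite mxE normr0 expr0n.
apply/rowP => j; rewrite mxE; apply/eqP; rewrite -normr_eq0 -sqrf_eq0.
by rewrite eq_le -{1}v0 sqnorm_ge exprn_ge0.
Qed.

Lemma sqnormZ n a (v : 'rV[C]_n) : sqnorm (a *: v) = `|a| ^+ 2 * sqnorm v.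
Proof. by rewrite /sqnorm mulr_sumr; apply: eq_bigr => j _; rewrite mxE normrM exprMn. Qed.

Lemma sqnorm_row_mx m n (u : 'rV[C]_m) (v : 'rV[C]_n) :
  sqnorm (row_mx u v) = sqnorm u + sqnorm v.
Proof.
rewrite /sqnorm big_split_ord /=; congr (_ + _); apply: eq_bigr => j _.
  by rewrite row_mxEl.
by rewrite row_mxEr.
Qed.

Lemma sqnorm_unitary m n (v : 'rV[C]_m) (Q : 'M[C]_(m, n)) :
  Q \is unitarymx -> sqnorm (v *m Q) = sqnorm v.
Proof.
move=> /unitarymxP QQ; rewrite !sqnormE trmx_mul map_mxM mulmxA.
by rewrite -(mulmxA v) QQ mulmx1.
Qed.

Lemma mulVunitary n (Q : 'M[C]_n) : Q \is unitarymx -> Q ^t* *m Q = 1%:M.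
Proof. by rewrite -trmxC_unitary => /unitarymxP; rewrite trmxCK. Qed.

Lemma unitary_entry_le1 n (Q : 'M[C]_n) i j : Q \is unitarymx -> `|Q i j| <= 1.
Proof.
move=> uQ; have := sqnorm_ge (row i Q) j.
rewrite rowE sqnorm_unitary // -rowE mxE /sqnorm (bigD1 i) //= big1.
  by rewrite mxE !eqxx normr1 expr1n addr0 expr_le1.
by move=> k ki; rewrite mxE (negPf ki) andbF normr0 expr0n.
Qed.

Lemma norm_det_unitary n (Q : 'M[C]_n) : Q \is unitarymx -> `|\det Q| = 1.
Proof.
move=> /unitarymxP /(congr1 determinant); rewrite det_mulmx det_map_mx det_tr det1.
by rewrite -normCK => /eqP; rewrite sqrp_eq1 // => /eqP.
Qed.

(** The Leibniz expansion is enough here: its factorial is absorbed by the final exponent. *)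
Lemma norm_det_le n (A : 'M[C]_n) (a : 'I_n -> C) :
  (forall i j, `|A i j| <= a i) -> `|\det A| <= n`!%:R * \prod_i a i.
Proof.
move=> Aa; apply: le_trans (ler_norm_sum _ _ _) _.
apply: (@le_trans _ _ (\sum_(s : 'S_n) \prod_i a i)).
  apply: ler_sum => s _; rewrite normrM normrX normrN1 expr1n mul1r normr_prod.
  by apply: ler_prod => i _; rewrite normr_ge0 Aa.
by rewrite sumr_const mulr_natl card_Sn.
Qed.

(* Gram-Schmidt applied to [row_ebase U], whose first [\rank U] rows span [U]. *)
Lemma unitary_frame h n (U : 'M[C]_(h, n)) :
  exists2 Q : 'M[C]_n, Q \is unitarymx &
    forall l (W : 'M[C]_(l, n)), (W <= U)%MS <->
      (forall i (j : 'I_n), (\rank U <= j)%N -> (W *m Q ^t*) i j = 0).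
Proof.
pose Q := schmidt (row_ebase U).
have uQ : Q \is unitarymx by apply: schmidt_unitarymx.
pose Q1 : 'M[C]_n := pid_mx (\rank U) *m Q.
have UQ1 : (U <= Q1)%MS.
  rewrite -(eq_row_base U) /row_base; apply/row_subP => i.
  have le_i : (i < n)%N by apply: leq_trans (ltn_ord i) (rank_leq_col U).
  have -> : row i (pid_mx (\rank U) *m row_ebase U) = row (Ordinal le_i) (row_ebase U).
    rewrite row_mul; set r := row i _.
    have -> : r = delta_mx 0 (Ordinal le_i).
      by apply/rowP => j; rewrite !mxE eqxx /= ltn_ord andbT eq_sym.
    by rewrite -rowE.
  apply: submx_trans (row_schmidt_sub _ _) _.
  apply/sumsmx_subP => k /= ki; rewrite genmxE.
  suff -> : row k (schmidt (row_ebase U)) = row k Q1 by apply: row_sub.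
  rewrite row_mul [in LHS]rowE; congr (_ *m _); apply/rowP => j.
  by rewrite !mxE eqxx /= (leq_ltn_trans ki) // andbT eq_sym.
have rQ1 : \rank Q1 = \rank U.
  by rewrite mxrankMfree ?row_free_unit ?unitarymx_unit // rank_pid_mx ?rank_leq_col.
have UQ : (U :=: Q1)%MS.
  by apply/eqmxP; rewrite -mxrank_leqif_eq // rQ1.
exists Q => // l W; rewrite UQ; split=> [/submxP[D ->] i j lej | W0].
  rewrite /Q1 mulmxA mulmxtVK // mxE big1 // => k _; rewrite mxE.
  by case: eqP => [->|]; rewrite ?andbF ?(ltnNge j) ?lej ?mulr0 //= mulr0.
have -> : W = W *m Q ^t* *m Q1.
  rewrite /Q1 mulmxA.
  suff -> : W *m Q ^t* *m pid_mx (\rank U) = W *m Q ^t*.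
    by rewrite mulmxKtV.
  apply/matrixP => i j; rewrite mxE (bigD1 j) //= big1 => [|k kj].
    rewrite addr0 [in X in _ * X]mxE eqxx /=.
    by case: ltnP => [|lej]; rewrite ?mulr1 // W0 // mul0r.
  by rewrite [in X in _ * X]mxE (negPf (_ : k != j :> nat)) ?mulr0.
exact: submxMl.
Qed.

End HermitianNorm.

(** * Reduced bases of lattices over the Gaussian integers *)

Section ReducedBasis.
Variable R : realType.
Local Notation C := R[i].
Local Notation G_int := (@gaussInt R).

(** Without a minimum up to the factor 3/4, the values would descend geometrically and fall below
    [e]. Settling for a near minimum avoids proving that the minimum is attained. *)
Lemma near_minimum (T : Type) (P : T -> Prop) (f : T -> C) (e : C) :
  0 < e -> (exists x, P x) -> (forall x, P x -> e <= f x) ->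
  exists2 x, P x & forall y, P y -> 3%:R / 4%:R * f x <= f y.
Proof.
move=> e_gt0 [x0 Px0] f_ge; apply: contrapT => no_min.
have freal x : P x -> f x \is Num.real.
  by move=> /f_ge/(lt_le_trans e_gt0)/gtr0_real.
have descent k : exists2 x, P x & f x <= (3%:R / 4%:R) ^+ k * f x0.
  elim: k => [|k [x Px fx]]; first by exists x0; rewrite // expr0 mul1r.
  have [y Py lt_y] : exists2 y, P y & f y < 3%:R / 4%:R * f x.
    apply: contrapT => no_y; apply: no_min; exists x => // y Py.
    rewrite real_leNgt ?freal ?realM ?freal // ?realV ?realn //.
    by apply/negP => lt_y; apply: no_y; exists y.
  exists y => //; apply: le_trans (ltW lt_y) _; rewrite exprS.
  by rewrite -[_ * _ * f x0]mulrA ler_pM2l // divr_gt0 ?ltr0n.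
have /complex_realP[a fa] := freal _ Px0.
have /complex_realP[b eb] := gtr0_real e_gt0.
have b_gt0 : 0 < b by move: e_gt0; rewrite eb -[0]/(0%:C) ltcR.
have bernoulli k : k%:R / 3%:R * (3%:R / 4%:R) ^+ k <= 1 :> R.
  suff : k%:R / 3%:R <= (4%:R / 3%:R) ^+ k :> R.
    have p_gt0 : 0 < (3%:R / 4%:R : R) ^+ k by rewrite exprn_gt0 // divr_gt0 ?ltr0n.
    rewrite -(ler_pM2r p_gt0) -exprMn.
    have -> : 4%:R / 3%:R * (3%:R / 4%:R) = 1 :> R by lra.
    by rewrite expr1n.
  elim: k => [|k IH]; first by rewrite mul0r expr0.
  have p_ge1 : 1 <= (4%:R / 3%:R : R) ^+ k by rewrite exprn_ege1 //; lra.
  rewrite exprS -addn1 natrD mulrDl; lra.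
(* As [k > 3 a / b], the inequality [bernoulli] gives [(3/4)^k a < b], a value of [f] below [e]. *)
pose k := Num.bound (3%:R * a / b).
have [x Px] := descent k; have := f_ge _ Px => le1 /(le_trans le1).
rewrite fa eb.
have -> : (3%:R / 4%:R) ^+ k = ((3%:R / 4%:R) ^+ k : R)%:C.
  by rewrite rmorphXn /= fmorph_div /= !rmorph_nat.
rewrite -rmorphM /= lecR => le_b.
have a_gt0 : 0 < a.
  by have := lt_le_trans e_gt0 (f_ge _ Px0); rewrite fa -[0]/(0%:C) ltcR.
have lt_k : 3%:R * a / b < k%:R.
  by apply: archi_boundP; rewrite divr_ge0 ?mulr_ge0 ?ltW.
have := bernoulli k; have p_gt0 : 0 < (3%:R / 4%:R : R) ^+ k.
  by rewrite exprn_gt0 // divr_gt0 ?ltr0n.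
move: lt_k; rewrite ltr_pdivrMr //.
move: p_gt0 le_b; set p := _ ^+ k => p_gt0 le_b lt_k le1'.
have h1 : 3%:R * a * p < k%:R * b * p by rewrite ltr_pM2r.
have h2 : k%:R / 3%:R * p * b <= b by rewrite ger_pMl.
clear -h1 h2 le_b; lra.
Qed.

Definition gauss_module n (L : 'rV[C]_n -> Prop) :=
  L 0 /\ forall a u v, a \in G_int -> L u -> L v -> L (a *: u + v).

Lemma gauss_module_comb m n (L : 'rV[C]_n -> Prop) (c : 'rV[C]_m)
    (Y : 'M[C]_(m, n)) :
  gauss_module L -> c \is a mxOver G_int -> (forall i, L (row i Y)) ->
  L (c *m Y).
Proof.
move=> [L0 LD] /mxOverP cG LY; rewrite mulmx_sum_row.
by elim/big_rec: _ => // i w _ Lw; apply: LD.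
Qed.

(** Putting [v] in place of row [i] of [Y] gives determinant [(v *m \adj Y) 0 i], which is nonzero
    for some [i]; the determinant bound then keeps [v] from being short. That bound encodes
    discreteness in a form that passes to projected lattices. *)
Lemma lattice_sqnorm_ge n (L : 'rV[C]_n -> Prop) (e : C) (Y : 'M[C]_n) :
  0 < e ->
  (forall X : 'M[C]_n, (forall i, L (row i X)) -> \det X != 0 -> e <= `|\det X|) ->
  (forall i, L (row i Y)) -> \det Y != 0 ->
  exists2 d : C, 0 < d & forall v, L v -> v != 0 -> d <= sqnorm v.
Proof.
move=> e_gt0 Ldet LY dY.
pose K : C := 1 + \sum_i \sum_j `|(\adj Y) j i|.
have S_ge0 i : 0 <= \sum_j `|(\adj Y) j i| by apply: sumr_ge0.
have K_gt0 : 0 < K by rewrite ltr_pwDl ?ltr01 ?sumr_ge0.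
exists ((e / K) ^+ 2) => [|v Lv v_neq0]; first by rewrite exprn_gt0 ?divr_gt0.
have [i vi] : exists i, (v *m \adj Y) 0 i != 0.
  apply: contrapT => no_i; case/eqP: v_neq0.
  have /(congr1 (mulmx^~ Y)) : v *m \adj Y = 0.
    apply/rowP => i; rewrite [RHS]mxE; apply/eqP; apply: contrapT => /negP vi.
    by apply: no_i; exists i.
  rewrite -mulmxA mul_adj_mx mul_mx_scalar mul0mx => /eqP.
  by rewrite scaler_eq0 (negPf dY) => /eqP.
pose X : 'M[C]_n := \matrix_k (if k == i then v else row k Y).
have detX : \det X = (v *m \adj Y) 0 i.
  rewrite (expand_det_row _ i) mxE; apply: eq_bigr => j _.
  rewrite [X i j]mxE eqxx [(\adj Y) _ _]mxE; congr (_ * _).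
  rewrite /cofactor; congr (_ * \det _); apply/matrixP => a b.
  by rewrite !mxE eq_sym (negPf (neq_lift _ _)) mxE.
have LX k : L (row k X) by rewrite rowK; case: eqP.
have := Ldet X LX; rewrite detX => /(_ vi) le_e.
rewrite real_leNgt ?ger0_real ?sqnorm_ge0 ?exprn_ge0 ?divr_ge0 ?ltW //.
apply/negP => lt_v.
have eK_ge0 : 0 <= e / K by rewrite divr_ge0 ?ltW.
have lt_vj j : `|v 0 j| <= e / K.
  rewrite -ler_sqr ?nnegrE //.
  exact: le_trans (sqnorm_ge v j) (ltW lt_v).
have : e < e; last by rewrite ltxx.
apply: le_lt_trans le_e _.
rewrite mxE; apply: le_lt_trans (ler_norm_sum _ _ _) _.
apply: (@le_lt_trans _ _ (e / K * \sum_j `|(\adj Y) j i|)).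
  rewrite mulr_sumr; apply: ler_sum => j _; rewrite normrM.
  by rewrite ler_wpM2r.
rewrite mulrAC ltr_pdivrMr // ltr_pM2l //.
apply: (@le_lt_trans _ _ (\sum_i \sum_j `|(\adj Y) j i|)).
  by rewrite [leRHS](bigD1 i) //= lerDl sumr_ge0.
by rewrite ltrDr ltr01.
Qed.

(** Row [i] of [T] holds the coordinates of the basis vector [i] in its Gram-Schmidt frame, so
    [|T i i|] is a Gram-Schmidt length. The third clause is a weak size reduction; the fourth lets
    these lengths drop by at most a factor 2 per step. *)
Definition reduced_trig n (T : 'M[C]_n) :=
  [/\ forall i j : 'I_n, (i < j)%N -> T i j = 0,
      forall i, T i i != 0,
      forall i j : 'I_n, (j <= i)%N -> `|T i j| <= `|T j j|
    & forall i j : 'I_n, (j <= i)%N -> `|T j j| <= 2%:R ^+ (i - j) * `|T i i|].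

(* Korkin-Zolotarev reduction: a nearly shortest vector is split off, and the *)
(* rest is found in the projection of the lattice along it.                   *)
Lemma reduced_basis n (L : 'rV[C]_n -> Prop) (e : C) :
  gauss_module L -> 0 < e ->
  (forall X : 'M[C]_n, (forall i, L (row i X)) -> \det X != 0 -> e <= `|\det X|) ->
  (exists2 Y : 'M[C]_n, (forall i, L (row i Y)) & \det Y != 0) ->
  exists T Q : 'M[C]_n,
    [/\ Q \is unitarymx, reduced_trig T, forall i, L (row i (T *m Q))
      & forall v, L v -> exists2 c, c \is a mxOver G_int & v = c *m (T *m Q)].
Proof.
elim: n L e => [|n IH] L e.
  move=> _ _ _ _; exists 1%:M, 1%:M; split; try by [case|split; case].
    by apply/unitarymxP; apply/matrixP; case.
  by move=> v _; exists 0; [rewrite mxOver0 ?rpred0 | apply/rowP; case].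
move: L; rewrite -[n.+1]/(1 + n)%N => L Lmod e_gt0 Ldet [Y LY dY].
have [d d_gt0 Lnorm] := lattice_sqnorm_ge e_gt0 Ldet LY dY.
have uY : Y \in unitmx by rewrite unitmxE unitfE.
have [] := @near_minimum _ (fun v => L v /\ v != 0) (@sqnorm C (1 + n)) d d_gt0.
- exists (row (@ord0 n) Y); split=> //; apply/eqP => Y0; move: dY.
  rewrite (expand_det_row _ (@ord0 n)) big1 ?eqxx // => j _.
  by have /rowP/(_ j) := Y0; rewrite !mxE => ->; rewrite mul0r.
- by move=> v [] /Lnorm.
move=> v [Lv v_neq0] vmin.
(* In a frame with first axis along [v], the vector [v] becomes [(t, 0)]. *)
have [Q1 uQ1 framev] := unitary_frame v.
pose t := (v *m Q1 ^t*) 0 (@ord0 n).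
have vQ1 : v = row_mx t%:M 0 *m Q1 :> 'rV_(1 + n).
  rewrite -[LHS](mulmxKtV _ uQ1) //; congr (_ *m _); apply/rowP => j.
  case: (split_ordP j) => k ->.
    rewrite row_mxEl ord1 [RHS]mxE eqxx mulr1n /t.
    by congr (_ 0 _); apply: val_inj.
  rewrite row_mxEr [RHS]mxE.
  apply: (framev _ v).1 (submx_refl v) 0 (rshift 1 k) _.
  exact: leq_trans (rank_leq_row v) _.
have sqv : sqnorm v = `|t| ^+ 2.
  rewrite vQ1 sqnorm_unitary // sqnorm_row_mx /sqnorm big_ord1 mxE mulr1n.
  by rewrite big1 ?addr0 // => j _; rewrite mxE normr0 expr0n.
have t_neq0 : t != 0 by rewrite -normr_eq0 -sqrf_eq0 -sqv sqnorm_eq0.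
(* The projection of the lattice along [v]; [x] is the coordinate that is forgotten. *)
pose L' (w : 'rV[C]_n) := exists x : 'M[C]_1, L (row_mx x w *m Q1).
have blockL (X : 'cV[C]_n) (Z : 'M[C]_n) : (forall i, L (row_mx (row i X) (row i Z) *m Q1)) ->
    forall i, L (row i (block_mx t%:M 0 X Z *m Q1)).
  move=> LXZ i; rewrite row_mul; case: (split_ordP i) => k ->.
    by rewrite rowKu ord1 row_id -vQ1.
  by rewrite rowKd row_row_mx.
have L'mod : gauss_module L'.
  split; first by exists 0; rewrite row_mx0 mul0mx; case: Lmod.
  move=> a u w aG [x Lx] [y Ly]; exists (a *: x + y).
  rewrite -add_row_mx -scale_row_mx mulmxDl -scalemxAl.
  by case: Lmod => _; apply.
have L'det (Z : 'M[C]_n) :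
    (forall i, L' (row i Z)) -> \det Z != 0 -> e / `|t| <= `|\det Z|.
  move=> /choice[x Lx] dZ.
  have := Ldet (block_mx t%:M 0 (\matrix_i x i) Z *m Q1).
  rewrite det_mulmx (det_lblock t%:M) det_scalar1 !normrM (norm_det_unitary uQ1) mulr1.
  rewrite ler_pdivrMr ?normr_gt0 // [_ * `|t|]mulrC; apply.
    by apply: blockL => i; rewrite rowK.
  rewrite !mulf_neq0 //; by rewrite -normr_eq0 norm_det_unitary ?oner_eq0.
have L'span : exists2 Z : 'M[C]_n, (forall i, L' (row i Z)) & \det Z != 0.
  pose Z : 'M[C]_(1 + n) := Y *m Q1 ^t*.
  have ZQ1 : Z *m Q1 = Y by rewrite mulmxKtV.
  have uZ : Z \in unitmx.
    by rewrite unitmx_mul uY unitarymx_unit // trmxC_unitary.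
  (* The projected rows of [Y] still span, so [n] independent ones can be selected. *)
  have full : row_full (rsubmx Z).
    have -> : rsubmx Z = Z *m col_mx 0 1%:M.
      by rewrite -{2}[Z]hsubmxK mul_row_col mulmx0 mulmx1 add0r.
    rewrite -sub1mx eqmxMfull ?row_full_unit //.
    by rewrite -addsmxE addsmxSr.
  exists (rowsub (fullrankfun full) (rsubmx Z)); last first.
    by have := fullrowsub_unit full; rewrite unitmxE unitfE.
  move=> i; exists (row (fullrankfun full i) (lsubmx Z)).
  by rewrite row_rowsub -row_row_mx hsubmxK -row_mul ZQ1.
have e'_gt0 : 0 < e / `|t| by rewrite divr_gt0 ?normr_gt0.
have [T' [Q' [uQ' [trigT' T'n0 T'size T'dec] LT' genT']]] :=
  IH L' _ L'mod e'_gt0 L'det L'span.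
(* Size reduction: subtracting a Gaussian multiple of [v] from any lift brings its first coordinate
   down to squared modulus [|t|^2 / 2]. *)
have lift i : exists x : 'M[C]_1,
    L (row_mx x (row i (T' *m Q')) *m Q1) /\ `|x 0 0| ^+ 2 <= 2^-1 * `|t| ^+ 2.
  have [x Lx] := LT' i; have [z zG xz] := gaussInt_approx (x 0 0 / t).
  exists (x - (z * t)%:M); split.
    have -> : row_mx (x - (z * t)%:M) (row i (T' *m Q')) *m Q1 =
        - z *: v + row_mx x (row i (T' *m Q')) *m Q1.
      rewrite vQ1 scalemxAl -mulmxDl scale_row_mx add_row_mx scaler0 add0r.
      by rewrite scale_scalar_mx mulNr raddfN addrC.
    by case: Lmod => _; apply; rewrite ?rpredN.
  have -> : (x - (z * t)%:M) 0 0 = (x 0 0 / t - z) * t.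
    by rewrite !mxE mulr1n mulrBl divfK.
  by rewrite normrM exprMn ler_wpM2r ?exprn_ge0.
have [x xP] := choice lift.
pose X : 'cV[C]_n := \matrix_i x i.
pose T : 'M[C]_(1 + n) := block_mx t%:M 0 X T'.
pose Q : 'M[C]_(1 + n) := block_mx 1%:M 0 0 Q' *m Q1.
have TQ : T *m Q = block_mx t%:M 0 X (T' *m Q') *m Q1.
  by rewrite /T /Q mulmxA mulmx_block !mulmx0 !mul0mx !mulmx1 !addr0 add0r.
have XE i : X i 0 = x i 0 0 by rewrite mxE.
have sq_le (a b : C) : 0 <= a -> 0 <= b -> a ^+ 2 <= b ^+ 2 -> a <= b.
  by move=> a0 b0; rewrite ler_sqr ?nnegrE.
have Xle i : `|X i 0| <= `|t|.
  rewrite sq_le // XE; apply: le_trans (xP i).2 _.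
  by rewrite ler_piMl ?exprn_ge0 // invf_le1 ?ler1n.
(* Near minimality of [v] against the first lifted vector: [3/4 |t|^2 <= 1/2 |t|^2 + |T' o o|^2]. *)
have tle (o : 'I_n) : o = 0%N :> nat -> `|t| <= 2%:R * `|T' o o|.
  move=> o0; have sqT' : sqnorm (row o (T' *m Q')) = `|T' o o| ^+ 2.
    rewrite row_mul sqnorm_unitary // /sqnorm (bigD1 o) //= big1 ?addr0 ?mxE //.
    move=> j jo; rewrite mxE trigT' ?normr0 ?expr0n //.
    by rewrite o0 lt0n -o0; apply: contraNneq jo => /val_inj ->.
  have := vmin (row_mx (x o) (row o (T' *m Q')) *m Q1).
  rewrite sqnorm_unitary // sqnorm_row_mx sqT' sqv {1}/sqnorm big_ord1.
  have pos : 0 < `|x o 0 0| ^+ 2 + `|T' o o| ^+ 2.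
    by rewrite ltr_wpDl ?exprn_ge0 // exprn_gt0 // normr_gt0.
  have neq0 : row_mx (x o) (row o (T' *m Q')) *m Q1 != 0.
    rewrite -sqnorm_eq0 sqnorm_unitary // sqnorm_row_mx sqT' {1}/sqnorm big_ord1.
    by rewrite gt_eqF.
  move=> /(_ (conj (xP o).1 neq0)) le34.
  rewrite sq_le ?mulr_ge0 // exprMn.
  have := le_trans le34 (lerD (xP o).2 (lexx _)).
  rewrite -lerBlDl -mulrBl.
  have -> : 3%:R / 4%:R - 2^-1 = 4%:R^-1 :> C by field.
  by rewrite -[2%:R ^+ 2]natrX mulrC ler_pdivrMr ?ltr0n // mulrC.
exists T, Q; split.
- rewrite mul_unitarymx //; apply/unitarymxP.
  rewrite tr_block_mx map_block_mx !trmx0 !map_mx0 trmx1 map_mx1 mulmx_block.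
  by rewrite !mulmx0 !mul0mx mulmx1 !addr0 add0r (unitarymxP uQ') -scalar_mx_block.
- split=> [i j|i|i j|i j].
  + case: (split_ordP i) => i' ->;
      case: (split_ordP j) => j' ->; rewrite ?ord1 /= => lt_ij.
    * by [].
    * by rewrite /T block_mxEur mxE.
    * by [].
    * by rewrite /T block_mxEdr trigT'.
  + case: (split_ordP i) => i' ->.
      by rewrite /T block_mxEul mxE ord1 mulr1n.
    by rewrite /T block_mxEdr.
  + case: (split_ordP i) => i' ->;
      case: (split_ordP j) => j' ->; rewrite ?ord1 // /T => le_ij.
    * by rewrite block_mxEdl block_mxEul [t%:M _ _]mxE mulr1n.
    * by rewrite !block_mxEdr T'size.
  + case: (split_ordP i) => i' ->;
      case: (split_ordP j) => j' ->; rewrite ?ord1 // /T => le_ij.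
    * by rewrite subnn expr0 mul1r.
    * rewrite block_mxEdr block_mxEul mxE mulr1n /= subn0 exprS -mulrA.
      have n_gt0 : (0 < n)%N by apply: leq_trans (ltn_ord i').
      apply: le_trans (tle (Ordinal n_gt0) erefl) _.
      rewrite ler_pM2l ?ltr0n //.
      by have := T'dec i' (Ordinal n_gt0) (leq0n _); rewrite subn0.
    * by rewrite !block_mxEdr /= subnDl T'dec.
- rewrite TQ; apply: blockL => i; rewrite rowK; exact: (xP i).1.
move=> u Lu.
pose w := u *m Q1 ^t* : 'rV_(1 + n).
have wQ1 : w *m Q1 = u by rewrite mulmxKtV.
have [|c cG wc] := genT' (rsubmx w).
  by exists (lsubmx w); rewrite hsubmxK wQ1.
pose a := (lsubmx w - c *m X) 0 0 / t.
have uE : u = a *: v + c *m (row_mx X (T' *m Q') *m Q1).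
  rewrite vQ1 mulmxA scalemxAl -mulmxDl mul_mx_row scale_row_mx add_row_mx.
  rewrite scaler0 add0r -wc scale_scalar_mx divfK //.
  rewrite -mx11_scalar subrK hsubmxK wQ1 //.
have Lc : L (c *m (row_mx X (T' *m Q') *m Q1)).
  apply: gauss_module_comb => // i; rewrite row_mul row_row_mx rowK.
  exact: (xP i).1.
have Lav : L (a *: v).
  have -> : a *: v = -1 *: (c *m (row_mx X (T' *m Q') *m Q1)) + u.
    by rewrite uE scaleN1r addrCA addNr addr0.
  by case: Lmod => _; apply; rewrite ?rpredN ?rpred1.
have [z zG az] := gaussInt_approx a.
(* [(a - z) *: v] is in the lattice with at most half the squared norm of [v], so near minimality
   forces it to vanish. *)
have azv : a = z.
  apply/eqP; rewrite -subr_eq0; apply: contraT => az_neq0.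
  have := vmin ((a - z) *: v).
  have Laz : L ((a - z) *: v).
    by rewrite addrC scalerDl; case: Lmod => _; apply; rewrite ?rpredN.
  have neq0 : (a - z) *: v != 0 by rewrite scaler_eq0 negb_or az_neq0.
  rewrite sqnormZ => /(_ (conj Laz neq0)) le34.
  have v_gt0 : 0 < sqnorm v by rewrite lt0r sqnorm_eq0 v_neq0 sqnorm_ge0.
  have := le_trans le34 (ler_wpM2r (ltW v_gt0) az).
  rewrite ler_pM2r // -subr_ge0.
  have -> : 2^-1 - 3%:R / 4%:R = - 4%:R^-1 :> C by field.
  by rewrite oppr_ge0 lt_geF ?invr_gt0 ?ltr0n.
exists (row_mx a%:M c : 'rV_(1 + n)).
  apply/mxOverP => i j; case: (split_ordP j) => k ->.
    by rewrite row_mxEl mxE azv; case: eqP => _; rewrite ?mulr1n ?mulr0n ?rpred0.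
  by rewrite row_mxEr (mxOverP cG).
rewrite TQ block_mxEv mulmxA mul_row_col mul_scalar_mx mulmxDl -!scalemxAl -vQ1.
by rewrite -[in RHS]mulmxA.
Qed.

End ReducedBasis.

(** * Images of row spaces under a family of matrices *)

Section Images.
Variables (K : fieldType) (n m p : nat) (F : 'I_p -> 'M[K]_(n, m)).

(** In row convention, with [F i] the transpose of [A i], this is the sum of the images of [U] under
    the [A i]. *)
Definition imagemx h (U : 'M[K]_(h, n)) : 'M[K]_m := (\sum_i <<U *m F i>>)%MS.

Lemma sub_imagemx h (U : 'M[K]_(h, n)) i : (U *m F i <= imagemx U)%MS.
Proof. by rewrite /imagemx (sumsmx_sup i) // genmxE. Qed.

Lemma row_pid_mul j h (B : 'M[K]_(n, h)) (i : 'I_j) (i' : 'I_n) :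
  i = i' :> nat -> row i ((pid_mx j : 'M[K]_(j, n)) *m B) = row i' B.
Proof.
move=> ii'; rewrite row_mul [RHS]rowE; congr (_ *m _); apply/rowP => l.
by rewrite !mxE eqxx /= ltn_ord andbT ii' eq_sym.
Qed.

(** A greedy choice: the images of the first [kap l] rows span more than [l] dimensions, so one of
    them escapes the [l] vectors already chosen. *)
Lemma free_images (B : 'M[K]_n) (kap : nat -> nat) r :
  (forall l, (l < r)%N -> (kap l <= n)%N) ->
  (forall l, (l < r)%N ->
    (l < \rank (imagemx ((pid_mx (kap l) : 'M[K]_(kap l, n)) *m B)))%N) ->
  exists (w : nat -> 'rV[K]_m),
    row_free (\matrix_(l < r) w l) /\
    forall l, (l < r)%N -> exists (i : 'I_n) (t : 'I_p),
      (i < kap l)%N /\ w l = row i B *m F t.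
Proof.
elim: r => [|r IH] kap_le kap_rank.
  by exists (fun=> 0); split=> //; rewrite /row_free eqn_leq rank_leq_row.
have [l lr|l lr|w [w_free wP]] := IH; [exact/kap_le/ltnW|exact/kap_rank/ltnW|].
have := kap_rank r (ltnSn r); have := kap_le r (ltnSn r).
set Br := _ *m B => kr rank_r.
have [t nt] : exists t, ~~ (Br *m F t <= \matrix_(l < r) w l)%MS.
  apply/existsP; apply: contraLR rank_r; rewrite negb_exists -leqNgt => /forallP all_t.
  apply: leq_trans (rank_leq_row (\matrix_(l < r) w l)); apply: mxrankS.
  by apply/sumsmx_subP => t _; rewrite genmxE; have := all_t t; rewrite negbK.
have /row_subPn[ i ] := nt.
rewrite row_mul; set i' := widen_ord kr i; rewrite (@row_pid_mul _ _ B i i') //.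
move=> new; exists (fun l => if l == r then row i' B *m F t else w l).
set W' := \matrix_(_ < _) _; pose u := row i' B *m F t; split; last first.
  move=> l; rewrite ltnS leq_eqVlt => /orP[/eqP->|lr].
    by exists i', t; rewrite eqxx; split=> //; apply: ltn_ord i.
  by rewrite (ltn_eqF lr); apply: wP.
have WW' : (\matrix_(l < r) w l <= W')%MS.
  apply/row_subP => l; apply: (eq_row_sub (widen_ord (leqnSn r) l)).
  by rewrite !rowK /= ltn_eqF.
have uW' : (u <= W')%MS by apply: (eq_row_sub ord_max); rewrite rowK /= eqxx.
rewrite -row_leq_rank; apply: (@leq_trans (\rank (\matrix_(l < r) w l + u)%MS)).
  have -> : r.+1 = (\rank (\matrix_(l < r) w l)).+1 by rewrite (eqP w_free).
  have : (\matrix_(l < r) w l < \matrix_(l < r) w l + u)%MS.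
    rewrite ltmxE addsmxSl /=; apply: contra new; apply: submx_trans.
    exact: addsmxSr.
  by rewrite ltmxErank => /andP[].
by apply: mxrankS; rewrite addsmx_sub WW'.
Qed.

End Images.

(** * Short bases of rational subspaces *)

Lemma choice2 X Y (P P' : X -> Y -> Prop) :
  (forall x, exists2 y, P x y & P' x y) ->
  exists2 f, forall x, P x (f x) & forall x, P' x (f x).
Proof.
move=> /(_ _)/cid2 f; exists (fun x => s2val (f x)) => x; case: (f x) => //.
Qed.

Lemma ler_prod_inj (C : numDomainType) (I J : finType) (e : I -> J) (a : J -> C) :
  injective e -> (forall j, 1 <= a j) -> \prod_i a (e i) <= \prod_j a j.
Proof.
move=> e_inj a_ge1.
have a_ge0 j : 0 <= a j by apply: le_trans (a_ge1 j).
rewrite [leRHS](bigID (mem (e @: I))) /=.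
rewrite (@big_imset _ _ _ _ _ e (mem I) a) /=; last by move=> ? ? _ _ /e_inj.
rewrite -[leLHS]mulr1; apply: ler_wpM2l; first by rewrite prodr_ge0.
by elim/big_rec: _ => // j x _ x1; rewrite mulr_ege1.
Qed.

Lemma gaussInt_bounded_finite (R : realType) n (x : R) : 0 <= x ->
  exists (I : finType) (dec : I -> 'rV[R[i]]_n),
    forall b : 'rV[R[i]]_n, b \is a mxOver (@gaussInt R) ->
      (forall j, `|b 0 j| <= x%:C) -> exists c, dec c = b.
Proof.
move=> x_ge0; pose K := Num.bound x; have x_lt : x < K%:R by apply: archi_boundP.
pose dec1 (o : 'I_(K.*2.+1)) : R := (o : nat)%:R - K%:R.
exists {ffun 'I_n -> 'I_(K.*2.+1) * 'I_(K.*2.+1)}.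
exists (fun c : {ffun 'I_n -> _} => \row_j (dec1 (c j).1 +i* dec1 (c j).2)) => b bG b_le.
have code (r : R) : r \is a Num.int -> r ^+ 2 <= x ^+ 2 -> exists o, dec1 o = r.
  move=> /intrP[z ->]; rewrite -rmorphXn /= => rx.
  have zK : (z ^+ 2 <= K%:Z ^+ 2).
    rewrite -(ler_int R); apply: le_trans rx _; rewrite rmorphXn /=.
    by rewrite ler_sqr ?nnegrE // ltW.
  have o_lt : (absz (z + K%:Z)%R < K.*2.+1)%N by nia.
  exists (Ordinal o_lt); rewrite /dec1 /= natr_absz ger0_norm; last by nia.
  by rewrite intrD addrK.
have /choice[c cP] : forall j, exists o,
    dec1 o.1 +i* dec1 o.2 = b 0 j.
  move=> j; have := b_le j; have := mxOverP bG 0 j; case: (b 0 j) => u v.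
  rewrite gaussIntE => /andP[uZ vZ]; rewrite -ler_sqr ?nnegrE ?normr_ge0 ?ler0c //.
  rewrite -add_Re2_Im2 -rmorphXn /= lecR => uv.
  have ux : u ^+ 2 <= x ^+ 2 by apply: le_trans uv; rewrite lerDl sqr_ge0.
  have vx : v ^+ 2 <= x ^+ 2 by apply: le_trans uv; rewrite lerDr sqr_ge0.
  have [[o <-] [o' <-]] := (code u uZ ux, code v vZ vx).
  by exists (o, o').
by exists (finfun c); apply/rowP => j; rewrite mxE ffunE cP.
Qed.

(** For [c <= j] this lists [c, c+1, ...] with [j] left out. The values serve as prefix lengths,
    that is, one-based positions in the basis. *)
Definition enum_skip c j l := if (c + l < j)%N then (c + l)%N else (c + l).+1.

Lemma enum_skip_le c j n l : (l < n - c)%N -> (enum_skip c j l <= n)%N.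
Proof. by rewrite /enum_skip => ln; case: ifP; lia. Qed.

Lemma enum_skip_inj c j : injective (enum_skip c j).
Proof. by move=> l l'; rewrite /enum_skip; do 2 case: ifP; lia. Qed.

Lemma enum_skip_neq c j l : enum_skip c j l <> j.
Proof. by rewrite /enum_skip; case: ifP; lia. Qed.

Lemma enum_skip_gt0 c j l : (0 < c)%N -> (0 < enum_skip c j l)%N.
Proof. by rewrite /enum_skip => c_gt0; case: ifP; lia. Qed.

Section ShortBasis.
Variable R : realType.
Local Notation C := R[i].
Variables (n m p : nat) (F : 'I_p -> 'M[C]_(n, m)) (M : C).
Variables (h : nat) (U : 'M[C]_(h, n)).
Let k : nat := \rank U.
Let s : nat := \rank (imagemx F U).

Hypothesis M_ge1 : 1 <= M.
Hypothesis F_int : forall i, F i \is a mxOver (@gaussInt R).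
Hypothesis F_le : forall i j l, `|F i j l| <= M.
(** With [f(V) = \rank V - \rank (imagemx F V)], these two hypotheses make [U] the least maximizer
    of [f]; sums replace differences because subtraction truncates. *)
Hypothesis U_max : forall l (V : 'M[C]_(l, n)),
  (\rank V + s <= k + \rank (imagemx F V))%N.
Hypothesis U_min : forall l (V : 'M[C]_(l, n)),
  (\rank V + s = k + \rank (imagemx F V))%N -> (U <= V)%MS.

(* [n ^ n] bounds the factorial of a determinant expansion, [n ^ 3 * M] the    *)
(* growth of a vector under [F], [n ^ 2 * 2 ^ n] the defect of orthogonality    *)
(* of a reduced basis, and the other [2 ^ n] its defect of monotonicity.       *)
Definition short_bound : C :=
  2%:R ^+ n * (n%:R ^+ n * (n%:R ^+ 3 * M * 2%:R ^+ n) ^+ n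
               * (n%:R ^+ 2 * 2%:R ^+ n) ^+ n).

(** * The norm stretched by [tau] orthogonally to [U] *)

Section Frame.
Variables (Q : 'M[C]_n) (tau : C).
Hypothesis Q_unitary : Q \is unitarymx.
Hypothesis Q_frame : forall l (W : 'M[C]_(l, n)), (W <= U)%MS <->
  (forall i (j : 'I_n), (k <= j)%N -> (W *m Q ^t*) i j = 0).
Hypothesis tau_ge1 : 1 <= tau.

Let wt N r : 'rV[C]_N := \row_j (if (j < r)%N then 1 else tau).

Let tau_gt0 : 0 < tau. Proof. exact: lt_le_trans tau_ge1. Qed.

Let det_wt N r : (r <= N)%N -> \det (diag_mx (wt N r)) = tau ^+ (N - r).
Proof.
move=> rN; rewrite det_diag.
transitivity (\prod_(0 <= j < N) (if (j < r)%N then 1 else tau)).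
  by rewrite big_mkord; apply: eq_bigr => j _; rewrite mxE.
rewrite (big_cat_nat (n := r)) //= big_nat big1 ?mul1r; last first.
  by move=> j /andP[_ ->].
rewrite big_nat (eq_bigr (fun=> tau)) ?prodr_const_nat; last first.
  by move=> j /andP[rj _]; rewrite ltnNge rj.
by rewrite -big_nat prodr_const_nat.
Qed.

(** Passes to coordinates in the frame [Q], whose first [k] rows span [U], and stretches the other
    coordinates by [tau]. *)
Let E : 'M[C]_n := Q ^t* *m diag_mx (wt n k).
Let Einv : 'M[C]_n := diag_mx (map_mx (fun z => z^-1) (wt n k)) *m Q.

Let k_le_n : (k <= n)%N. Proof. exact: rank_leq_col. Qed.
Let s_le_k : (s <= k)%N.
Proof.
have := U_max (0 : 'M_(0, n)); rewrite mxrank0 add0n => /leq_trans; apply.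
rewrite -[leqRHS]addn0 leq_add2l leqn0 mxrank_eq0 -submx0.
by apply/sumsmx_subP => i _; rewrite mul0mx genmx0 submx0.
Qed.

Let EK : E *m Einv = 1%:M.
Proof.
rewrite /E /Einv mulmxA -(mulmxA (Q ^t*)) mulmx_diag.
set D := diag_mx _; have -> : D = 1%:M.
  rewrite -diag_const_mx; congr diag_mx; apply/rowP => j; rewrite !mxE.
  by case: ifP => _; rewrite mulfV ?oner_eq0 ?gt_eqF.
by rewrite mulmx1 mulVunitary.
Qed.

Let norm_det_E : `|\det E| = tau ^+ (n - k).
Proof.
rewrite det_mulmx normrM norm_det_unitary ?trmxC_unitary // mul1r det_wt //.
by rewrite ger0_norm // exprn_ge0 // ltW.
Qed.

Let det_E_neq0 : \det E != 0.
Proof. by rewrite -normr_eq0 norm_det_E expf_neq0 // gt_eqF. Qed.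

Let N : C := n%:R ^+ 2 * 2%:R ^+ n.

(** [reduced_basis] is applied to the image of the Gaussian lattice under [E]. Each [a i] is a
    Gram-Schmidt length times [N], which also covers the unstretched entries; the product of the
    Gram-Schmidt lengths is at most the covolume [tau^(n-k)]. *)
Lemma reduced_lattice_basis : (0 < n)%N ->
  exists (B : 'M[C]_n) (a : 'I_n -> C),
    [/\ B \is a mxOver (@gaussInt R) /\ B \in unitmx,
        forall i, 1 <= a i,
        forall i j : 'I_n, (i <= j)%N -> a i <= 2%:R ^+ n * a j,
        \prod_i a i <= N ^+ n * tau ^+ (n - k) &
        forall i j, `|B i j| <= a i /\ `|(B *m E) i j| <= a i].
Proof.
move=> n_gt0; pose L v := exists2 b : 'rV[C]_n, b \is a mxOver (@gaussInt R) & v = b *m E.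
have Lmod : gauss_module L.
  split; first by exists 0; rewrite ?mul0mx // mxOver0 ?rpred0.
  move=> a _ _ aG [b bG ->] [c cG ->]; exists (a *: b + c).
    by rewrite rpredD ?mxOverZ.
  by rewrite mulmxDl scalemxAl.
have detE_gt0 : 0 < `|\det E| by rewrite normr_gt0.
have [||T [Qu [uQu [Ttrig Tn0 Tsize Tdec] LT Tgen]]] := reduced_basis Lmod detE_gt0.
- move=> X /choice2[b bG Xb]; have -> : X = (\matrix_i b i) *m E.
    by apply/row_matrixP => i; rewrite Xb row_mul rowK.
  rewrite det_mulmx mulf_eq0 negb_or => /andP[db _].
  rewrite normrM ler_peMl //; apply: gaussInt_norm_ge1 db.
  by apply: det_gaussInt; apply/mxOverP => i j; rewrite mxE (mxOverP (bG i)).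
- exists E => // i; exists (row i 1%:M); last by rewrite -row_mul mul1mx.
  by apply/mxOverP => x y; rewrite !mxE rpred_nat.
have [b bG Tb] := choice2 LT; pose B := \matrix_i b i.
have BG : B \is a mxOver (@gaussInt R).
  by apply/mxOverP => i j; rewrite mxE (mxOverP (bG i)).
have TB : T *m Qu = B *m E by apply/row_matrixP => i; rewrite Tb row_mul rowK.
have [i|c cG Ec] := choice2 (fun i => Tgen (row i E) _).
  exists (row i 1%:M); last by rewrite -row_mul mul1mx.
  by apply/mxOverP => x y; rewrite !mxE rpred_nat.
pose V := \matrix_i c i.
have VB : V *m B = 1%:M.
  have VBE : V *m B *m E = E.
    by rewrite -mulmxA -TB; apply/row_matrixP => i; rewrite row_mul rowK -Ec.
  by rewrite -[LHS]mulmx1 -EK mulmxA VBE.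
have uB : B \in unitmx by have /mulmx1_unit[] := VB.
have detB : `|\det B| <= 1.
  have VG : V \is a mxOver (@gaussInt R).
    by apply/mxOverP => i j; rewrite mxE (mxOverP (cG i)).
  have /(congr1 Num.norm) := congr1 determinant VB.
  rewrite det_mulmx det1 normr1 normrM => <-; rewrite ler_peMl //.
  apply: gaussInt_norm_ge1; first exact: det_gaussInt.
  by have /mulmx1_unit[+ _] := VB; rewrite unitmxE unitfE.
have n_ge1 : 1 <= n%:R :> C by rewrite ler1n.
have TQ_le i j : `|(B *m E) i j| <= n%:R * 2%:R ^+ n * `|T i i|.
  rewrite -TB mxE; apply: le_trans (ler_norm_sum _ _ _) _.
  apply: (@le_trans _ _ (\sum_(l < n) 2%:R ^+ n * `|T i i|)); last first.
    by rewrite sumr_const card_ord -[leLHS]mulr_natl mulrA.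
  apply: ler_sum => l _; rewrite normrM -[leRHS]mulr1.
  apply: ler_pM => //; last exact: unitary_entry_le1.
  have [il|li] := ltnP i l.
    by rewrite (Ttrig _ _ il) normr0 mulr_ge0 ?exprn_ge0.
  apply: le_trans (Tsize _ _ li) _; apply: le_trans (Tdec _ _ li) _.
  rewrite ler_wpM2r // ler_weXn2l ?ler1n //.
  exact: leq_trans (leq_subr _ _) (ltnW (ltn_ord i)).
have B_le i j : `|B i j| <= N * `|T i i|.
  have -> : B = (B *m E) *m Einv by rewrite -mulmxA EK mulmx1.
  rewrite mxE; apply: le_trans (ler_norm_sum _ _ _) _.
  apply: (@le_trans _ _ (\sum_(l < n) n%:R * 2%:R ^+ n * `|T i i|)); last first.
    by rewrite sumr_const card_ord -[leLHS]mulr_natl /N expr2 !mulrA.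
  apply: ler_sum => l _; rewrite normrM -[leRHS]mulr1.
  apply: ler_pM; [exact: normr_ge0|exact: normr_ge0|exact: TQ_le|].
  (* Undoing the stretch divides by 1 or by [tau], so the entries of [Einv] have modulus at most
     1. *)
  have QE : `|Einv l j| = `|wt n k 0 l|^-1 * `|Q l j|.
    by rewrite /Einv mul_diag_mx !mxE normrM normfV.
  rewrite QE mulr_ile1 ?invr_ge0 ?normr_ge0 ?(unitary_entry_le1 _ _ Q_unitary) // mxE.
  by case: ifP => _; rewrite ?normr1 ?invr1 // (gtr0_norm tau_gt0) invf_le1.
have a_ge1 i : 1 <= N * `|T i i|.
  have [j Bij] : exists j, B i j != 0.
    apply: contrapT => no_j; move: uB; rewrite unitmxE unitfE.
    rewrite (expand_det_row _ i) big1 ?eqxx // => j _.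
    have -> : B i j = 0; last by rewrite mul0r.
    by apply: contrapT => /eqP Bij; apply: no_j; exists j.
  apply: le_trans (B_le i j); apply: gaussInt_norm_ge1 Bij.
  exact: (mxOverP BG).
have N_ge0 : 0 <= N by rewrite mulr_ge0 ?exprn_ge0.
exists B, (fun i => N * `|T i i|); split=> //.
- move=> i j ij; rewrite mulrCA ler_wpM2l //; apply: le_trans (Tdec _ _ ij) _.
  rewrite ler_wpM2r // ler_weXn2l ?ler1n //.
  exact: leq_trans (leq_subr _ _) (ltnW (ltn_ord j)).
- rewrite big_split prodr_const card_ord /= ler_wpM2l ?exprn_ge0 //.
  rewrite -normr_prod -det_trig; last by apply/is_trig_mxP.
  rewrite -norm_det_E -[leLHS]mulr1 -(norm_det_unitary uQu) -normrM -det_mulmx TB.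
  by rewrite det_mulmx normrM ler_piMl.
move=> i j; split=> //; apply: le_trans (TQ_le i j) _.
by rewrite ler_wpM2r // ler_wpM2r ?exprn_ge0 // expr2 ler_peMl // ler0n.
Qed.

(* A nonzero minor of the images is a Gaussian integer, hence at least 1 in    *)
(* absolute value; in frames adapted to [U] and to its image, the [tau]-scaled *)
(* coordinates of the images stay bounded by those of their sources.           *)
Lemma free_images_bound (B : 'M[C]_n) (a : 'I_n -> C) r (ix : 'I_r -> 'I_n)
    (tx : 'I_r -> 'I_p) :
  r = (n - k + s)%N -> B \is a mxOver (@gaussInt R) ->
  (forall i j, `|(B *m E) i j| <= a i) ->
  row_free (\matrix_l (row (ix l) B *m F (tx l))) ->
  tau ^+ (n - k) <= r`!%:R * \prod_l (n%:R ^+ 3 * M * a (ix l)).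
Proof.
move=> rE BG Ba; set W := \matrix_l _ => W_free.
have r_le : (r <= n)%N by rewrite rE -{2}(subnK k_le_n) leq_add2l.
have full : row_full W^T by rewrite /row_full mxrank_tr.
pose f := fullrankfun full.
(* Selects [r] columns on which the images have a nonzero minor. *)
pose S : 'M[C]_(m, r) := \matrix_(x, y) (x == f y)%:R.
have mulS u (X : 'M[C]_(u, m)) x y : (X *m S) x y = X x (f y).
  rewrite mxE (bigD1 (f y)) //= mxE eqxx mulr1 big1 ?addr0 // => z zf.
  by rewrite mxE (negPf zf) mulr0.
have WSE : W *m S = (rowsub f W^T)^T.
  by apply/matrixP => x y; rewrite mulS !mxE.
have det_WS : 1 <= `|\det (W *m S)|.
  apply: gaussInt_norm_ge1.
    apply: det_gaussInt; apply/mxOverP => x y; rewrite mulS [W _ _]mxE.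
    apply/mxOverP; apply: mxOverM => //.
    by apply/mxOverP => ? ?; rewrite mxE (mxOverP BG).
  by rewrite WSE det_tr; have := fullrowsub_unit full; rewrite unitmxE unitfE.
have [G uG G_frame] := unitary_frame (imagemx F U *m S).
have uGt : G ^t* \is unitarymx by rewrite trmxC_unitary.
pose H t := Q *m F t *m S *m G ^t*.
(* [F t] sends [U] into its image, so in the two frames the block leading from [U] out of that image
   vanishes. *)
have H0 t (x : 'I_n) (y : 'I_r) : (x < k)%N -> (s <= y)%N -> H t x y = 0.
  move=> xk sy.
  have -> : H t x y = (row x Q *m F t *m S *m G ^t*) 0 y.
    by rewrite -!row_mul [RHS]mxE.
  apply: (G_frame _ _).1; last by apply: leq_trans sy; apply: mxrankM_maxl.
  apply: submxMr; apply: submx_trans (sub_imagemx F U t); apply: submxMr.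
  apply/Q_frame => i j kj; rewrite -row_mul (unitarymxP Q_unitary) !mxE.
  by case: eqP => // xj; move: xk; rewrite xj ltnNge kj.
have M_ge0 : 0 <= M by apply: le_trans M_ge1.
have H_le t x y : `|H t x y| <= n%:R ^+ 2 * M.
  rewrite mxE; apply: le_trans (ler_norm_sum _ _ _) _.
  apply: (@le_trans _ _ (\sum_(z < r) n%:R * M)); last first.
    rewrite sumr_const card_ord -[leLHS]mulr_natl expr2 mulrA.
    by rewrite ler_wpM2r // ler_wpM2r // ler_nat.
  apply: ler_sum => z _; rewrite normrM -[leRHS]mulr1.
  apply: ler_pM; [exact: normr_ge0|exact: normr_ge0| |exact: unitary_entry_le1].
  rewrite mulS mxE; apply: le_trans (ler_norm_sum _ _ _) _.
  apply: (@le_trans _ _ (\sum_(w < n) M)); last first.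
    by rewrite sumr_const card_ord -[leLHS]mulr_natl.
  apply: ler_sum => w _; rewrite normrM -[leRHS]mul1r.
  by apply: ler_pM => //; apply: unitary_entry_le1.
(* Stretching the last [r - s = n - k] target coordinates multiplies the minor by [tau^(n-k)]. *)
pose Z := W *m S *m G ^t* *m diag_mx (wt r s).
have det_Z : tau ^+ (n - k) <= `|\det Z|.
  rewrite det_mulmx det_wt; last by rewrite rE leq_addl.
  rewrite det_mulmx !normrM (norm_det_unitary uGt) mulr1.
  have -> : (r - s = n - k)%N by rewrite rE addnK.
  rewrite (ger0_norm (exprn_ge0 _ (ltW tau_gt0))).
  by rewrite ler_peMl // exprn_ge0 // ltW.
apply: le_trans det_Z _; apply: norm_det_le => l y.
have -> : Z l y = \sum_x (B *m E) (ix l) x *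
    ((wt n k 0 x)^-1 * H (tx l) x y * wt r s 0 y).
  have -> : Z l y = (row l Z) 0 y by rewrite [RHS]mxE.
  have -> : row l Z = row (ix l) (B *m E) *m (diag_mx (map_mx (fun z => z^-1) (wt n k))
       *m H (tx l) *m diag_mx (wt r s)).
    have -> : row l Z = row (ix l) B *m F (tx l) *m S *m G ^t* *m diag_mx (wt r s).
      by rewrite /Z 3!row_mul rowK.
    have : row (ix l) B = row (ix l) (B *m E) *m Einv.
      by rewrite -row_mul -mulmxA EK mulmx1.
    move: (row (ix l) (B *m E)) (row (ix l) B) => v _ ->.
    by rewrite /H /Einv !mulmxA.
  rewrite mxE; apply: eq_bigr => x _; rewrite mul_mx_diag mul_diag_mx.
  by rewrite [row _ _ _ _]mxE; congr (_ * _); rewrite !mxE.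
apply: le_trans (ler_norm_sum _ _ _) _.
apply: (@le_trans _ _ (\sum_(x < n) a (ix l) * (n%:R ^+ 2 * M))); last first.
  rewrite sumr_const card_ord -[leLHS]mulr_natl [a _ * _]mulrC.
  by rewrite [_ ^+ 3]exprS !mulrA.
apply: ler_sum => x _; rewrite normrM; apply: ler_pM => //.
rewrite 2!normrM mulrAC; have := H_le (tx l) x y; have := @H0 (tx l) x y.
rewrite normfV !mxE.
(* The quotient of target weight by source weight exceeds 1 only if [x < k] and [s <= y], exactly
   where [H] vanishes. *)
case: (ltnP x k) => xk; case: (ltnP y s) => ys H00 le_H.
- by rewrite normr1 invr1 !mul1r.
- by rewrite H00 // normr0 mulr0 mulr_ge0 ?exprn_ge0.
- rewrite normr1 mulr1 (gtr0_norm tau_gt0); apply: le_trans le_H.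
  by rewrite ler_piMl // invf_le1.
- by rewrite mulVf ?mul1r // normr_eq0 gt_eqF.
Qed.

(** With [j0] the least prefix length whose span contains [U], independent images can be charged to
    basis vectors other than the last one of the prefix. They already use up the factor [tau^(n-k)]
    of the covolume, so that last vector, and by near monotonicity every earlier one, is bounded
    independently of [tau]. *)
Lemma short_prefix : (0 < n)%N ->
  exists (B : 'M[C]_n) (j0 : nat),
    [/\ (j0 <= n)%N, B \is a mxOver (@gaussInt R) /\ B \in unitmx,
        (U <= (pid_mx j0 : 'M[C]_(j0, n)) *m B)%MS
      & forall i j : 'I_n, (i < j0)%N ->
          `|B i j| <= short_bound /\ `|(B *m E) i j| <= short_bound].
Proof.
move=> n_gt0; have [B [a [[BG uB] a_ge1 a_dec a_prod B_le]]] := reduced_lattice_basis n_gt0.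
pose D j : nat := \rank (imagemx F ((pid_mx j : 'M[C]_(j, n)) *m B)).
have rank_prefix j : (j <= n)%N -> \rank ((pid_mx j : 'M[C]_(j, n)) *m B) = j.
  by move=> jn; rewrite mxrankMfree ?row_free_unit // rank_pid_mx.
have [j0 Uj0 j0_min] : exists2 j0, (U <= (pid_mx j0 : 'M[C]_(j0, n)) *m B)%MS &
    forall j, (U <= (pid_mx j : 'M[C]_(j, n)) *m B)%MS -> (j0 <= j)%N.
  have ex : exists j, (U <= (pid_mx j : 'M[C]_(j, n)) *m B)%MS.
    by exists n; rewrite pid_mx_1 mul1mx submx_full // row_full_unit.
  by exists (ex_minn ex); case: ex_minnP.
have j0n : (j0 <= n)%N.
  by apply: j0_min; rewrite pid_mx_1 mul1mx submx_full // row_full_unit.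
exists B, j0; split=> // i0 y i0j0.
have D_ge j : (j <= n)%N -> (j + s <= k + D j)%N.
  by move=> jn; rewrite -{1}(rank_prefix j jn) U_max.
(* Equality would make this prefix a maximizer, hence contain [U], against the choice of [j0]. *)
have D_gt j : (j < j0)%N -> (j + s < k + D j)%N.
  move=> jj0; have jn : (j <= n)%N by apply: leq_trans (ltnW jj0) j0n.
  rewrite ltn_neqAle D_ge // andbT; apply/eqP => eq_j.
  have : (j0 <= j)%N by apply: j0_min; apply: U_min; rewrite rank_prefix.
  by rewrite leqNgt jj0.
have D0 : D 0 = 0%N.
  apply/eqP; rewrite mxrank_eq0 -submx0.
  by apply/sumsmx_subP => i _; rewrite [pid_mx _]flatmx0 !mul0mx genmx0 submx0.
have s_lt_k : (s < k)%N.
  by have := D_gt 0%N; rewrite D0 add0n addn0; apply; apply: leq_ltn_trans i0j0.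
pose c := (k - s)%N; pose r := (n - k + s)%N.
have c_gt0 : (0 < c)%N by rewrite subn_gt0.
have rE : r = (n - c)%N by rewrite /r /c subnBA // addnBAC.
pose kap := enum_skip c j0.
have kap_le l : (l < r)%N -> (kap l <= n)%N by rewrite rE; apply: enum_skip_le.
have [||w [w_free wP]] := @free_images _ n m p F B kap r => //.
  (* More than [l] image dimensions are needed. Below [j0] the strict inequality gives them at
     prefix length [c + l]; from [j0] on only the weak one holds, and one more basis vector makes up
     for it. *)
  move=> l lr; rewrite -/(D (kap l)); have := kap_le l lr.
  have kE : k = (c + s)%N by rewrite subnK.
  rewrite /kap /enum_skip; case: ifP => [lt_j _|_ le_n].
    by have := D_gt _ lt_j; rewrite kE addnAC ltn_add2l.
  by have := D_ge _ le_n; rewrite kE addSn addnAC -addnS leq_add2l.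
have /choice[ix /choice[tx ixP]] : forall l : 'I_r,
    exists (i : 'I_n) (t : 'I_p), (i < kap l)%N /\ w l = row i B *m F t by move=> l; apply: wP.
have j0_gt0 : (0 < j0)%N by apply: leq_ltn_trans i0j0.
have J_lt : (j0.-1 < n)%N by rewrite prednK.
pose J := Ordinal J_lt.
have kap_gt0 l : (0 < kap l)%N by apply: enum_skip_gt0.
have e_lt (l : 'I_r) : ((kap l).-1 < n)%N by rewrite prednK // kap_le.
pose e l := Ordinal (e_lt l).
have e_inj : injective e.
  move=> l l' /(congr1 val) /= /(congr1 S); rewrite !prednK // => /enum_skip_inj.
  exact: val_inj.
have e_neq l : e l != J.
  apply/eqP => /(congr1 val) /= /(congr1 S); rewrite !prednK //.
  exact: enum_skip_neq.
pose K : C := n%:R ^+ 3 * M.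
have n_ge1 : 1 <= n%:R :> C by rewrite ler1n.
have K_ge1 : 1 <= K by rewrite mulr_ege1 // exprn_ege1.
have a_ge0 i : 0 <= a i by apply: le_trans (a_ge1 i).
have two_ge1 : 1 <= 2%:R ^+ n :> C by rewrite exprn_ege1 // ler1n.
have K2_ge1 : 1 <= K * 2%:R ^+ n by rewrite mulr_ege1.
(* The source [ix l] does not come after [e l], so its length is at most [2^n * a (e l)]. *)
have tau_le : tau ^+ (n - k) <= n%:R ^+ n * (K * 2%:R ^+ n) ^+ n * \prod_l a (e l).
  apply: le_trans (free_images_bound (a := a) (ix := ix) (tx := tx) erefl BG _ _) _.
  - by move=> i l; case: (B_le i l).
  - rewrite (_ : \matrix_l _ = \matrix_(l < r) w l) //.
    by apply/row_matrixP => l; rewrite !rowK (ixP l).2.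
  have r_le : (r <= n)%N by rewrite rE leq_subr.
  apply: (@le_trans _ _ (r`!%:R * \prod_l (K * 2%:R ^+ n * a (e l)))).
    rewrite ler_wpM2l //; apply: ler_prod => l _; rewrite mulr_ge0 ?a_ge0 //=; last first.
      by apply: le_trans K_ge1.
    rewrite -/K -[leRHS]mulrA ler_wpM2l //; first by apply: le_trans K_ge1.
    by apply: a_dec; rewrite /= -ltnS prednK //; case: (ixP l).
  rewrite big_split prodr_const card_ord /= mulrA ler_wpM2r ?prodr_ge0 //.
  apply: ler_pM => //; first by rewrite exprn_ge0 // (le_trans _ K2_ge1).
    rewrite -natrX ler_nat; apply: leq_trans (leq_pexp2l n_gt0 r_le).
    elim: (r) r_le => // r' IH r'n; rewrite factS expnS leq_mul // IH //.
    exact: ltnW.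
  by rewrite ler_weXn2l.
(* The positions [e l] are distinct and miss [J]; all remaining factors are at least 1. *)
have prod_a : a J * \prod_l a (e l) <= \prod_i a i.
  rewrite [leRHS](bigD1 J) //= ler_wpM2l //.
  pose a' i := if i == J then 1 else a i.
  have -> : \prod_(l < r) a (e l) = \prod_(l < r) a' (e l).
    by apply: eq_bigr => l _; rewrite /a' (negPf (e_neq l)).
  have -> : \prod_(i < n | i != J) a i = \prod_i a' i.
    rewrite [RHS](bigD1 J) //= /a' eqxx mul1r.
    by apply: eq_bigr => i iJ; rewrite (negPf iJ).
  by apply: ler_prod_inj => // i; rewrite /a'; case: eqP.
have tau_n_gt0 : 0 < tau ^+ (n - k) by rewrite exprn_gt0.
have aJ : a J <= n%:R ^+ n * (K * 2%:R ^+ n) ^+ n * N ^+ n.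
  rewrite -(ler_pM2r tau_n_gt0).
  apply: le_trans (ler_wpM2l (a_ge0 J) tau_le) _.
  rewrite mulrCA -[leRHS]mulrA ler_wpM2l //; last exact: le_trans a_prod.
  by rewrite mulr_ge0 ?exprn_ge0 // (le_trans _ K2_ge1).
have a_i0 : a i0 <= short_bound.
  apply: le_trans (a_dec i0 J _) _; first by rewrite /= -ltnS prednK.
  by rewrite ler_wpM2l // exprn_ge0.
by have [Bi BEi] := B_le i0 y; split; [apply: le_trans Bi _|apply: le_trans BEi _].
Qed.

End Frame.

Lemma short_bound_ge0 : 0 <= short_bound.
Proof.
have M_ge0 : 0 <= M by apply: le_trans M_ge1.
by rewrite !mulr_ge0 ?exprn_ge0 ?mulr_ge0 ?exprn_ge0.
Qed.

(* For [tau] large, the finitely many short Gaussian vectors outside [U] become *)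
(* too long, so the vectors found by [short_prefix] lie in [U].                 *)
Lemma short_gauss_basis : (0 < n)%N -> exists d (W : 'M[C]_(d, n)),
  [/\ W \is a mxOver (@gaussInt R), row_free W, (W :=: U)%MS
    & forall i j, `|W i j| <= short_bound].
Proof.
move=> n_gt0; have [Q uQ Q_frame] := unitary_frame U.
have /complex_realP[x xE] := ger0_real short_bound_ge0.
have x_ge0 : 0 <= x by rewrite -lecR -xE short_bound_ge0.
have [I [dec decP]] := gaussInt_bounded_finite n x_ge0.
(* Exceeds [short_bound / |z|] for each nonzero frame coordinate [z] of a coded vector; for [z = 0]
   the term is 0, division by zero being 0. *)
pose tau : C := 1 + \sum_(c : I) \sum_(j < n) short_bound / `|(dec c *m Q ^t*) 0 j|.
have term_ge0 c j : 0 <= short_bound / `|(dec c *m Q ^t*) 0 j|.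
  by rewrite divr_ge0 ?short_bound_ge0.
have tau_ge1 : 1 <= tau by rewrite lerDl sumr_ge0 // => c _; rewrite sumr_ge0.
have [B [j0 [j0n [BG uB] Uj0 B_le]]] := short_prefix uQ Q_frame tau_ge1 n_gt0.
pose W : 'M[C]_(j0, n) := pid_mx j0 *m B.
have WB i j : W i j = B (widen_ord j0n i) j.
  have /rowP/(_ j) := @row_pid_mul _ _ _ _ B i (widen_ord j0n i) erefl.
  by rewrite [RHS]mxE [LHS]mxE.
have W_free : row_free W.
  by rewrite /row_free mxrankMfree ?row_free_unit // rank_pid_mx.
have WU : (W <= U)%MS.
  apply/Q_frame => i j kj; apply/eqP; apply: contraT => z_neq0.
  pose i' := widen_ord j0n i.
  have rowE' : row i W = row i' B by apply: row_pid_mul.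
  have zE : (W *m Q ^t*) i j = (row i' B *m Q ^t*) 0 j.
    by rewrite -rowE' -row_mul [RHS]mxE.
  have [||c cE] := decP (row i' B).
  - by apply/mxOverP => ? ?; rewrite mxE (mxOverP BG).
  - by move=> l; rewrite mxE -xE; case: (B_le i' l (ltn_ord i)).
  have [_] := B_le i' j (ltn_ord i).
  have -> : (B *m (Q ^t* *m diag_mx (\row_j (if (j < \rank U)%N then 1 else tau)))) i' j
      = (row i' B *m Q ^t*) 0 j * tau.
    rewrite mulmxA mul_mx_diag mxE [in X in _ * X]mxE ltnNge kj /=.
    by congr (_ * _); rewrite -row_mul [RHS]mxE.
  move: z_neq0; rewrite zE -cE; set z := (_ *m _) 0 j => z_neq0.
  rewrite normrM (ger0_norm (le_trans ler01 tau_ge1)) => le_z.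
  have : short_bound / `|z| < tau.
    rewrite /tau; set S := \sum_c _; apply: (@le_lt_trans _ _ S); last first.
      by rewrite ltrDr ltr01.
    rewrite /S (bigD1 c) //= (bigD1 j) //= -/z -addrA lerDl addr_ge0 ?sumr_ge0 //.
    by move=> *; rewrite sumr_ge0.
  by rewrite ltr_pdivrMr ?normr_gt0 // mulrC (le_gtF le_z).
exists j0, W; split=> //.
- by apply/mxOverP => i j; rewrite WB (mxOverP BG).
- by apply/eqmxP; rewrite WU.
by move=> i j; rewrite WB; case: (B_le (widen_ord j0n i) j (ltn_ord i)).
Qed.

End ShortBasis.

(** * Column subspaces as row spaces *)

Section RowSpaces.
Variable C : numClosedFieldType.

Definition rowvs h n (W : 'M[C]_(h, n)) : {vspace 'cV[C]_n} :=
  limg (linfun (trmx \o mulmxr W : 'rV[C]_h -> 'cV[C]_n)).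

(** The very matrix inside [orth_proj], so that [orth_projE] can fold it. *)
Definition vsmx n (U : {vspace 'cV[C]_n}) : 'M[C]_(\dim U, n) :=
  \matrix_(i < \dim U) ((vbasis U)`_i)^T.

Lemma mem_rowvs h n (W : 'M[C]_(h, n)) y : (y \in rowvs W) = (y^T <= W)%MS.
Proof.
apply/memv_imgP/submxP => [[c _ ->]|[c yc]]; exists c.
- by rewrite lfunE /= trmxK.
- exact: memvf.
- by rewrite lfunE /= -yc trmxK.
Qed.

Lemma dim_rowvs h n (W : 'M[C]_(h, n)) : \dim (rowvs W) = \rank W.
Proof.
have -> : rowvs W = rowvs (row_base W).
  by apply/vspaceP => y; rewrite !mem_rowvs eq_row_base.
rewrite limg_dim_eq; first by rewrite dimvf /dim /= mul1n.
apply/eqP; rewrite -subv0; apply/subvP => c; rewrite memv_cap memv0 => /andP[_].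
rewrite memv_ker lfunE /= -trmx0 (inj_eq trmx_inj).
by rewrite mulmx_free_eq0 // row_base_free.
Qed.

Lemma sub_vsmx n (U : {vspace 'cV[C]_n}) (w : 'cV[C]_n) :
  (w^T <= vsmx U)%MS = (w \in U).
Proof.
apply/idP/idP => [/submxP[D wD]|wU].
  have -> : w = \sum_(i < \dim U) D 0 i *: (vbasis U)`_i.
    apply: trmx_inj; rewrite wD mulmx_sum_row raddf_sum /=.
    by apply: eq_bigr => i _; rewrite rowK [RHS]linearZ.
  by apply: memv_suml => i _; apply/memvZ/vbasis_mem/mem_nth; rewrite size_tuple.
rewrite (coord_vbasis wU) raddf_sum /=; apply: summx_sub => i _.
by rewrite linearZ /= scalemx_sub // -(rowK (fun i => ((vbasis U)`_i)^T)) row_sub.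
Qed.

Lemma rowvs_vsmx n (U : {vspace 'cV[C]_n}) : rowvs (vsmx U) = U.
Proof. by apply/vspaceP => y; rewrite mem_rowvs sub_vsmx. Qed.

Lemma rank_vsmx n (U : {vspace 'cV[C]_n}) : \rank (vsmx U) = \dim U.
Proof. by rewrite -dim_rowvs rowvs_vsmx. Qed.

(** * Dominance expressed through ranks of images *)

Section Dominant.
Variables (m n p : nat) (A : 'I_p -> 'M[C]_(m, n)).
Let F i := (A i)^T.

Lemma form_trmx (x : 'cV[C]_m) (y : 'cV[C]_n) i :
  (x ^t* *m A i *m y = 0) <-> (y^T *m F i *m x^T ^t* = 0).
Proof.
have -> : y^T *m F i *m x^T ^t* = (x ^t* *m A i *m y)^T.
  by rewrite !trmx_mul mulmxA map_trmx trmxK.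
by split=> [->|/(congr1 trmx)]; rewrite ?trmx0 // trmxK.
Qed.

(** Independence places [L] in the Hermitian orthogonal complement of the images of [Rr]. *)
Lemma dim_independent L Rr : independent A L Rr ->
  (\dim L + \rank (imagemx F (vsmx Rr)) <= m)%N.
Proof.
move=> ind; set I := imagemx F _; rewrite -rank_vsmx.
have IX : I *m (vsmx L) ^t* = 0.
  apply/sub_kermxP/sumsmx_subP => i _; rewrite genmxE; apply/sub_kermxP.
  apply/matrixP => a b; rewrite [RHS]mxE.
  have memrow d (V : {vspace 'cV[C]_d}) c : (row c (vsmx V))^T \in V.
    by rewrite -sub_vsmx trmxK row_sub.
  have /form_trmx := ind _ _ i (memrow _ L b) (memrow _ Rr a).
  rewrite !trmxK => /matrixP/(_ 0 0); rewrite [RHS]mxE => <-.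
  rewrite -row_mul !mxE; apply: eq_bigr => j _; by rewrite !mxE.
by have := mulmx0_rank_max IX; rewrite mxrank_map mxrank_tr addnC.
Qed.

Lemma independent_rowvs h (V : 'M[C]_(h, n)) :
  independent A (rowvs (kermx ((imagemx F V) ^t*))) (rowvs V).
Proof.
move=> x y i; rewrite !mem_rowvs => /sub_kermxP xI yV; apply/form_trmx.
have /submxP[D ->] : (y^T *m F i <= imagemx F V)%MS.
  exact: submx_trans (submxMr _ yV) (sub_imagemx F V i).
rewrite -mulmxA; set z := _ *m x^T ^t*; suff -> : z = 0 by rewrite mulmx0.
rewrite -[z]trmxCK.
have -> : z ^t* = 0 by rewrite /z trmx_mul map_mxM trmxCK.
by rewrite trmx0 map_mx0.
Qed.

Lemma dim_independent_rowvs h (V : 'M[C]_(h, n)) :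
  \dim (rowvs (kermx ((imagemx F V) ^t*))) = (m - \rank (imagemx F V))%N.
Proof. by rewrite dim_rowvs mxrank_ker mxrank_map mxrank_tr. Qed.

Variables (Ls : {vspace 'cV[C]_m}) (Rs : {vspace 'cV[C]_n}).
Hypothesis dom : dominant_independent A Ls Rs.
Let s : nat := \rank (imagemx F (vsmx Rs)).

Let dims : (\dim Ls + \dim Rs <= m - s + \rank (vsmx Rs))%N.
Proof.
rewrite rank_vsmx leq_add2r; have := dim_independent dom.1.1; rewrite -/s.
lia.
Qed.

(** [V] paired with the orthogonal complement of its image is independent, of total dimension
    [\rank V + m - \rank (imagemx F V)]; maximality of [(Ls, Rs)] bounds this. *)
Lemma dominant_max h (V : 'M[C]_(h, n)) :
  (\rank V + s <= \rank (vsmx Rs) + \rank (imagemx F V))%N.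
Proof.
have := leq_trans (dom.1.2 _ _ (@independent_rowvs _ V)) dims.
rewrite dim_independent_rowvs dim_rowvs.
have := rank_leq_col (imagemx F V); have := rank_leq_col (imagemx F (vsmx Rs)).
rewrite -/s; lia.
Qed.

(** Equality makes the pair built from [V] maximal, and dominance then puts [Rs] inside its right
    member. *)
Lemma dominant_min h (V : 'M[C]_(h, n)) :
  (\rank V + s = \rank (vsmx Rs) + \rank (imagemx F V))%N -> (vsmx Rs <= V)%MS.
Proof.
move=> eq_V.
have [|_ sub] := dom.2 (rowvs (kermx ((imagemx F V) ^t*))) (rowvs V).
  split=> [|L' R' /dom.1.2 /leq_trans]; first exact: independent_rowvs.
  apply; apply: leq_trans dims _; rewrite dim_independent_rowvs dim_rowvs.
  have := rank_leq_col (imagemx F V); have := rank_leq_col (imagemx F (vsmx Rs)).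
  by rewrite -/s; lia.
apply/row_subP => i; rewrite -[row i _]trmxK -mem_rowvs.
by apply: (subvP sub); rewrite -sub_vsmx trmxK row_sub.
Qed.

End Dominant.

(** * The Gram determinant as a denominator of the projection *)

Lemma gram_unit d n (W : 'M[C]_(d, n)) : row_free W -> W *m W ^t* \in unitmx.
Proof.
move=> W_free; rewrite -row_free_unit; apply/inj_row_free => v vG.
apply: (row_free_inj W_free); rewrite mul0mx; apply/eqP.
rewrite -sqnorm_eq0 sqnormE trmx_mul map_mxM mulmxA -(mulmxA v) vG.
by rewrite mul0mx mxE.
Qed.

(** The normal equations: the right-hand matrix, before transposition, has its row space in [W] and
    fixes [W], and [1 - P] maps into the orthogonal complement. *)
Lemma orth_projE d n (W : 'M[C]_(d, n)) (U : {vspace 'cV[C]_n}) :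
  row_free W -> (W :=: vsmx U)%MS ->
  orth_proj U = (W ^t* *m invmx (W *m W ^t*) *m W)^T.
Proof.
move=> W_free WU; congr trmx; rewrite -/(vsmx U).
pose P := W ^t* *m invmx (W *m W ^t*) *m W.
rewrite -[LHS]mul1mx -[1%:M](subrK P) mulmxDl.
rewrite proj_ortho_0 ?add0r ?proj_ortho_id //.
  by rewrite -WU submxMl.
apply/orthomx1P.
have /submxP[D ->] : (vsmx U <= W)%MS by rewrite WU.
rewrite trmx_mul map_mxM mulmxA mulmxBl mul1mx /P -!mulmxA.
by rewrite mulVmx ?gram_unit // mulmx1 subrr mul0mx.
Qed.

End RowSpaces.

(** By Cramer's rule, multiplying by the Gram determinant replaces the inverse by the adjugate,
    which is Gaussian integral. The Gram matrix is Hermitian, so its determinant is real, hence an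
    integer up to whose sign [D] is determined. *)
Lemma orth_proj_denominator (R : realType) d n (W : 'M[R[i]]_(d, n))
    (U : {vspace 'cV[R[i]]_n}) :
  W \is a mxOver (@gaussInt R) -> row_free W -> (W :=: vsmx U)%MS ->
  exists D : nat, [/\ (0 < D)%N, D%:R = `|\det (W *m W ^t*)| &
    forall j k, gaussian_int (D%:R * orth_proj U j k)].
Proof.
move=> WG W_free WU; set G := W *m W ^t*.
have WtG : W ^t* \is a mxOver (@gaussInt R).
  by apply/mxOverP => i j; rewrite !mxE gaussInt_conj // (mxOverP WG).
have GG : G \is a mxOver (@gaussInt R) by apply: mxOverM.
have uG : G \in unitmx by apply: gram_unit.
have dG : \det G \in @gaussInt R by apply: det_gaussInt.
have dG_neq0 : \det G != 0 by move: uG; rewrite unitmxE unitfE.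
have /complex_realP[r rE] : \det G \is Num.real.
  have GtG : G ^t* = G by rewrite /G trmx_mul map_mxM trmxCK.
  by rewrite CrealE -det_map_mx -[in eqbRHS]GtG -map_trmx det_tr.
have /gaussIntP[/intrP[z /= zE] _] : r%:C \in @gaussInt R by rewrite -rE.
have detE : \det G = z%:~R by rewrite rE zE rmorph_int.
have absE : (absz z)%:R = `|\det G| by rewrite detE natr_absz intr_norm.
exists (absz z); split=> //.
  rewrite absz_gt0; apply: contraNneq dG_neq0 => z0.
  by rewrite detE z0.
move=> j k; apply/gaussIntP; rewrite absE.
have -> : `|\det G| = (sgz z)%:~R * \det G.
  by rewrite -absE detE -intrM -abszEsg.
rewrite -mulrA rpredM ?rpred_int // (orth_projE W_free WU) mxE.
have -> : \det G * (W ^t* *m invmx G *m W) k j = (W ^t* *m \adj G *m W) k j.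
  have -> : \adj G = \det G *: invmx G by rewrite /invmx uG scalerA divff // scale1r.
  by rewrite -scalemxAr -scalemxAl [RHS]mxE.
by apply/mxOverP; rewrite !mxOverM ?adj_gaussInt.
Qed.

(** * Numerical estimates and the final bound *)

Lemma short_bound_le (R : realType) n (M : R[i]) : (1 < n)%N -> 1 <= M ->
  short_bound n M <= (n%:R * M) ^+ (2 * n ^ 2 + 7 * n).
Proof.
move=> n_gt1 M_ge1; set X := n%:R * M.
have n_ge1 : 1 <= n%:R :> R[i] by rewrite ler1n ltnW.
have M_ge0 : 0 <= M by apply: le_trans M_ge1.
have nX : n%:R <= X by rewrite ler_peMr // ler0n.
have twoX : 2%:R <= X by apply: le_trans nX; rewrite ler_nat.
have X_ge0 : 0 <= X by apply: le_trans twoX.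
have two_n : 2%:R ^+ n <= X ^+ n by rewrite lerXn2r ?nnegrE.
have n3M : n%:R ^+ 3 * M <= X ^+ 3.
  by rewrite exprMn ler_wpM2l ?exprn_ge0 // exprS ler_peMr // exprn_ege1.
(* The exponents add up as [n + n + (n^2 + 3n) + (n^2 + 2n)]; each factor 2 is absorbed by [X]
   because [n >= 2]. *)
have -> : X ^+ (2 * n ^ 2 + 7 * n) =
    X ^+ n * (X ^+ n * (X ^+ 3 * X ^+ n) ^+ n * (X ^+ 2 * X ^+ n) ^+ n).
  by rewrite -!exprD -!exprM -!exprD; congr (_ ^+ _); lia.
have pow_le (a b : R[i]) e : 0 <= a -> a <= b -> a ^+ e <= b ^+ e.
  by move=> a_ge0 ab; rewrite lerXn2r ?nnegrE ?(le_trans a_ge0).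
have pow_ge0 (a : R[i]) e : 0 <= a -> 0 <= a ^+ e by apply: exprn_ge0.
have two_ge0 : 0 <= 2%:R ^+ n :> R[i] by apply: pow_ge0.
have n_ge0 e : 0 <= n%:R ^+ e :> R[i] by apply: pow_ge0.
have n3M_ge0 : 0 <= n%:R ^+ 3 * M by rewrite mulr_ge0.
have le3 : (n%:R ^+ 3 * M * 2%:R ^+ n) ^+ n <= (X ^+ 3 * X ^+ n) ^+ n.
  by apply: (pow_le); [rewrite mulr_ge0|apply: ler_pM].
have le2 : (n%:R ^+ 2 * 2%:R ^+ n) ^+ n <= (X ^+ 2 * X ^+ n) ^+ n.
  by apply: (pow_le); [rewrite mulr_ge0|apply: ler_pM => //; apply: (pow_le)].
have ge3 : 0 <= (n%:R ^+ 3 * M * 2%:R ^+ n) ^+ n by rewrite pow_ge0 // mulr_ge0.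
have ge2 : 0 <= (n%:R ^+ 2 * 2%:R ^+ n) ^+ n :> R[i] by rewrite pow_ge0 // mulr_ge0.
apply: ler_pM => //; first by rewrite !mulr_ge0.
apply: ler_pM => //; first by rewrite mulr_ge0.
by apply: ler_pM => //; apply: pow_le.
Qed.

Lemma gram_det_le (C : numClosedFieldType) d n (W : 'M[C]_(d, n)) (b : C) :
  (forall i j, `|W i j| <= b) ->
  `|\det (W *m W ^t*)| <= d`!%:R * (n%:R * b ^+ 2) ^+ d.
Proof.
move=> W_le; rewrite -[X in _ ^+ X]card_ord -prodr_const.
apply: norm_det_le => i j; rewrite mxE; apply: le_trans (ler_norm_sum _ _ _) _.
apply: (@le_trans _ _ (\sum_(l < n) b ^+ 2)); last first.
  by rewrite sumr_const card_ord -[leLHS]mulr_natl.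
apply: ler_sum => l _; rewrite !mxE normrM norm_conjC expr2.
by apply: ler_pM.
Qed.

Theorem theorem3p14 (R : realType) :
  exists2 c : R, 0 < c &
  forall (m n p : nat) (M : R) (A : 'I_p -> 'M[R[i]]_(m, n))
         (Ls : {vspace 'cV[R[i]]_m}) (Rs : {vspace 'cV[R[i]]_n}),
    1 <= M ->
    (forall i j k, gaussian_int (A i j k) /\ `|A i j k| <= M%:C) ->
    dominant_independent A Ls Rs ->
    exists D : nat,
      [/\ (0 < D)%N,
          D%:R <= expR (c * n%:R ^+ 5 * ln (M * n%:R)) &
          forall j k, gaussian_int (D%:R * orth_proj Rs j k)].
Proof.
(* The final exponent of [M n] is [4 n^3 + 14 n^2 + 2 n], at most [20 n^5]. *)
exists 20%:R => // m n p M A Ls Rs M_ge1 A_int dom.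
pose U := vsmx Rs.
(* For [n <= 1] the logarithm may vanish, leaving only [D = 1]. The subspace is then zero or
   everything, and the empty or the identity basis has Gram determinant 1. *)
have [n_le1|n_gt1] := leqP n 1.
  have [D [D_gt0 D_det D_int]] : exists D : nat, [/\ (0 < D)%N, D%:R = 1 :> R[i] &
      forall j k, gaussian_int (D%:R * orth_proj Rs j k)].
    have [rk0|rk_gt0] := posnP (\rank U).
      have [|||D [D_gt0 D_det D_int]] := @orth_proj_denominator R 0 n 0 Rs.
      - by apply/mxOverP; case.
      - by rewrite /row_free mxrank0.
      - have -> : vsmx Rs = 0 by apply/eqP; rewrite -mxrank_eq0 -/U rk0.
        by apply/eqmxP; rewrite !sub0mx.
      by exists D; split=> //; rewrite D_det det_mx00 normr1.
    have U_full : row_full U by rewrite /row_full eqn_leq rank_leq_col (leq_trans n_le1).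
    have [|||D [D_gt0 D_det D_int]] := @orth_proj_denominator R n n 1%:M Rs.
    - by rewrite mxOver_scalar ?rpred0 ?rpred1.
    - by rewrite /row_free mxrank1.
    - by apply/eqmxP; rewrite submx1 submx_full.
    by exists D; split=> //; rewrite D_det mul1mx trmx1 map_mx1 det1 normr1.
  exists D; split=> //.
  have -> : D%:R = 1 :> R by apply: complexI; rewrite rmorph_nat.
  rewrite -[leLHS]expR0 ler_expR; case: n n_le1 {A Ls Rs A_int dom U D_int} => [|[|//]] _.
    by rewrite expr0n mulr0 mul0r.
  by rewrite expr1n !mulr1 mulr_ge0 // ln_ge0.
have M_ge1C : 1 <= M%:C by rewrite -[1]/(1%:C) lecR.
pose F i := (A i)^T.
have F_int i : F i \is a mxOver (@gaussInt R).
  by apply/mxOverP => j k; rewrite mxE; apply/gaussIntP; case: (A_int i k j).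
have F_le i j k : `|F i j k| <= M%:C by rewrite mxE; case: (A_int i k j).
have [d [W [WG W_free WU W_le]]] :=
  short_gauss_basis M_ge1C F_int F_le (dominant_max dom) (dominant_min dom) (ltnW n_gt1).
have [D [D_gt0 D_det D_int]] := orth_proj_denominator WG W_free WU.
exists D; split=> //.
pose X := M * n%:R.
have d_le : (d <= n)%N by rewrite -(eqP W_free) rank_leq_col.
have n_ge1 : 1 <= n%:R :> R by rewrite ler1n ltnW.
have nX : n%:R <= X by rewrite ler_peMl // ler0n.
have X_ge1 : 1 <= X by apply: le_trans nX.
have X_gt0 : 0 < X by apply: lt_le_trans X_ge1.
have D_le : D%:R <= X ^+ (20 * n ^ 5).
  rewrite -lecR rmorph_nat D_det rmorphXn /=.
  have XE : X%:C = n%:R * M%:C by rewrite mulrC rmorphM /= rmorph_nat.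
  have nXC : n%:R <= X%:C by rewrite -(rmorph_nat (real_complex R)) lecR.
  have X_ge1C : 1 <= X%:C by rewrite -[1]/(1%:C) lecR.
  have X_ge0C : 0 <= X%:C by apply: le_trans X_ge1C.
  set e := (2 * n ^ 2 + 7 * n)%N.
  have W_leX i j : `|W i j| <= X%:C ^+ e.
    by apply: le_trans (W_le i j) _; rewrite XE short_bound_le.
  apply: le_trans (gram_det_le W_leX) _.
  apply: (@le_trans _ _ (X%:C ^+ n * (X%:C * X%:C ^+ (e * 2)) ^+ n)); last first.
    rewrite -exprS -exprM -exprD ler_weXn2l // /e; nia.
  rewrite -exprM; apply: ler_pM => //; first by rewrite exprn_ge0 ?mulr_ge0 ?exprn_ge0.
    apply: (@le_trans _ _ (n%:R ^+ d)).
      rewrite -natrX ler_nat; elim: (d) d_le => // d' IH d'n.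
      by rewrite factS expnS leq_mul // IH // ltnW.
    apply: (@le_trans _ _ (X%:C ^+ d)); first by rewrite lerXn2r ?nnegrE.
    by rewrite ler_weXn2l.
  apply: (@le_trans _ _ ((X%:C * X%:C ^+ (e * 2)) ^+ d)).
    by rewrite lerXn2r ?nnegrE ?mulr_ge0 ?exprn_ge0 // ler_wpM2r ?exprn_ge0.
  by rewrite ler_weXn2l // -exprS exprn_ege1.
apply: le_trans D_le _.
have -> : 20%:R * n%:R ^+ 5 = (20 * n ^ 5)%:R :> R by rewrite natrM natrX.
by rewrite expRM_natl lnK.
Qed.
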